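(* Let $u_0\in\mathcal V_{[0,1]}$, $\varepsilon>0$, and let $(\tau_n)$ be a sequence of positive reals with $\tau_n\downarrow0$. Then there exists a subsequence $(\tau_n')$ of $(\tau_n)$ with $\tau_n'<\varepsilon$ for all $n$, such that along this subsequence the semi-discrete iterates $(u_m^{[\tau_n']},\beta_m^{[\tau_n']})$ with time step $\tau_n'$ and initial state $u_0$ converge to the Allen--Cahn (AC) solution with initial condition $u_0$, in the following sense. Let $(\hat u,\gamma)$ be the solution to double-obstacle AC flow on $[0,\infty)$ with $\hat u(0)=u_0$. Then for each $t\ge0$, with $m=\lceil t/\tau_n'\rceil$, $u_m^{[\tau_n']}\to\hat u(t)$ as $n\to\infty$; and there is a sequence $N_k\to\infty$ (independent of $t$) such that for almost every $t\ge0$, with $m=\lceil t/\tau_n'\rceil$ in the $n$-th summand, $$\frac1{N_k}\sum_{n=1}^{N_k}\beta_m^{[\tau_n']}\to\gamma(t)\quad\text{as }k\to\infty.$$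
   Context: Let $G=(V,E)$ be a finite, undirected, simple, connected graph with symmetric weights $\omega_{ij}=\omega_{ji}$, $\omega_{ij}>0$ for $ij\in E$ and $\omega_{ij}=0$ for $ij\notin E$. Let $d_i=\sum_{j}\omega_{ij}>0$ be the degree of $i\in V$. Fix $r\in[0,1]$. Let $\mathcal V=\{u:V\to\mathbb R\}$ and, for $X\subseteq\mathbb R$, $\mathcal V_X=\{u:V\to X\}$; $\mathcal V$ carries the inner product $\langle u,v\rangle_{\mathcal V}=\sum_{i\in V}u_iv_id_i^r$ with norm $\|\cdot\|_{\mathcal V}$. $\mathbf 1\in\mathcal V$ is the constant function $1$. The graph Laplacian is $(\Delta u)_i=d_i^{-r}\sum_{j\in V}\omega_{ij}(u_i-u_j)$, and $e^{-t\Delta}=\sum_{n\ge0}\frac{(-1)^nt^n}{n!}\Delta^n$. For an open interval $T$, $H^1(T;\mathcal V)$ is the set of $u\in L^2(T;\mathcal V)$ with generalised (weak) time derivative $du/dt\in L^2(T;\mathcal V)$. For any interval $T$, $H^1_{loc}(T;\mathcal V)$ is the set of $u:T\to\mathcal V$ with $u\in H^1((a,b);\mathcal V)$ for all $a,b\in T$ with $a<b$. For $u\in\mathcal V_{[0,1]}$, $\mathcal B(u)$ is the set of $\alpha\in\mathcal V$ such that for each $i\in V$: $\alpha_i\ge0$ if $u_i=0$, $\alpha_i=0$ if $0<u_i<1$, and $\alpha_i\le0$ if $u_i=1$. A pair $(u,\beta)$ with $u:T\to\mathcal V_{[0,1]}$, $\beta:T\to\mathcal V$ is a solution to double-obstacle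 AC flow on an interval $T$ if $u\in H^1_{loc}(T;\mathcal V)\cap C^0(T;\mathcal V)$ and for a.e. $t\in T$, $\varepsilon\frac{du}{dt}+\varepsilon\Delta u(t)+\frac12\mathbf 1-u(t)=\beta(t)$ and $\beta(t)\in\mathcal B(u(t))$. (On $[0,\infty)$ a solution exists for each initial condition in $\mathcal V_{[0,1]}$, with $u$ unique and $\beta$ unique up to a.e. equality.) Semi-discrete scheme with time step $\tau\in(0,\varepsilon)$ and initial state $u_0\in\mathcal V_{[0,1]}$: with $\lambda=\tau/\varepsilon$, $u^{[\tau]}_0=u_0$ and, for $n\ge0$, $(u^{[\tau]}_{n+1},\beta^{[\tau]}_{n+1})$ is the unique pair with $u^{[\tau]}_{n+1}\in\mathcal V_{[0,1]}$, $\beta^{[\tau]}_{n+1}\in\mathcal B(u^{[\tau]}_{n+1})$ and $(1-\lambda)u^{[\tau]}_{n+1}-e^{-\tau\Delta}u^{[\tau]}_n+\frac\lambda2\mathbf 1=\lambda\beta^{[\tau]}_{n+1}$. *)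

(* Defs.v *)
From HB Require Import structures.
From mathcomp Require Import all_boot all_order all_algebra.
From mathcomp Require Import all_classical all_reals all_analysis.

Set Implicit Arguments.
Unset Strict Implicit.
Unset Printing Implicit Defensive.

Import Order.TTheory GRing.Theory Num.Theory.
Import numFieldNormedType.Exports.

Local Open Scope classical_set_scope.
Local Open Scope ring_scope.

Definition degree (R : realType) (V : finType) (w : V -> V -> R) (i : V) : R :=
  \sum_(j : V) w i j.

Record weighted_graph (R : realType) (V : finType) (E : rel V)
    (w : V -> V -> R) : Prop := WeightedGraph {
  vertex_nonempty : (0 < #|V|)%N;
  edge_sym : symmetric E;
  edge_irrefl : irreflexive E;
  edge_connected : forall i j, connect E i j;
  weight_sym : forall i j, w i j = w j i;
  weight_gt0 : forall i j, E i j -> 0 < w i j;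
  weight_eq0 : forall i j, ~~ E i j -> w i j = 0;
  degree_gt0 : forall i, 0 < degree w i }.

Definition VX (R : realType) (V : finType) (X : set R) : set {ffun V -> R} :=
  [set u | forall i, X (u i)].

Definition V01 (R : realType) (V : finType) : set {ffun V -> R} :=
  VX `[0, 1].

Definition vone (R : realType) (V : finType) : {ffun V -> R} := [ffun=> 1].

Definition vdot (R : realType) (V : finType) (w : V -> V -> R) (r : R)
    (u v : {ffun V -> R}) : R :=
  \sum_(i : V) u i * v i * degree w i `^ r.

Definition vnorm (R : realType) (V : finType) (w : V -> V -> R) (r : R)
    (u : {ffun V -> R}) : R :=
  Num.sqrt (vdot w r u u).

(* {ffun V -> R} carries no topology in the library, so limits are expressed
   through vnorm. *)
Definition vcvg (R : realType) (V : finType) (w : V -> V -> R) (r : R)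
    (I : Type) (f : I -> {ffun V -> R}) (F : set_system I)
    (l : {ffun V -> R}) : Prop :=
  vnorm w r (f x - l) @[x --> F] --> (0 : R).

Definition laplacian (R : realType) (V : finType) (w : V -> V -> R) (r : R)
    (u : {ffun V -> R}) : {ffun V -> R} :=
  [ffun i => degree w i `^ (- r) * \sum_(j : V) w i j * (u i - u j)].

(* exp (- t Laplacian) u: the exponential series is applied to u and summed
   coordinatewise (V is finite and the series always converges). *)
Definition heat (R : realType) (V : finType) (w : V -> V -> R) (r t : R)
    (u : {ffun V -> R}) : {ffun V -> R} :=
  [ffun i => limn (series (fun n : nat =>
     (-1) ^+ n * t ^+ n / n`!%:R * iter n (laplacian w r) u i))].

Definition obstacle (R : realType) (V : finType) (u : {ffun V -> R}) :
    set {ffun V -> R} :=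
  [set alpha | forall i, [/\ u i = 0 -> 0 <= alpha i,
                             0 < u i < 1 -> alpha i = 0
                           & u i = 1 -> alpha i <= 0]].

Definition test_function (R : realType) (T : set R) (phi : R -> R) : Prop :=
  (forall (n : nat) (t : R), derivable (derive1n n phi) t 1) /\
  exists K : set R, [/\ compact K, K `<=` T & forall t, ~ K t -> phi t = 0].

(* Borel measurability of all coordinates is no restriction: elements of L^2
   are only considered up to a.e. equality. *)
Definition L2 (R : realType) (V : finType) (w : V -> V -> R) (r : R)
    (T : set R) (u : R -> {ffun V -> R}) : Prop :=
  (forall i, measurable_fun T (fun t => u t i)) /\
  (\int[@lebesgue_measure R]_(t in T) (vnorm w r (u t) ^+ 2)%:E < +oo)%E.

Definition weak_derivative (R : realType) (V : finType) (T : set R)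
    (u v : R -> {ffun V -> R}) : Prop :=
  forall phi : R -> R, test_function T phi -> forall i : V,
    \int[@lebesgue_measure R]_(t in T) (u t i * derive1 phi t) =
    - \int[@lebesgue_measure R]_(t in T) (v t i * phi t).

Definition H1 (R : realType) (V : finType) (w : V -> V -> R) (r : R)
    (T : set R) (u : R -> {ffun V -> R}) : Prop :=
  L2 w r T u /\
  exists v : R -> {ffun V -> R}, L2 w r T v /\ weak_derivative T u v.

(* Functions on an interval T are total functions on R of which only the
   restriction to T matters. *)
Definition H1loc (R : realType) (V : finType) (w : V -> V -> R) (r : R)
    (T : interval R) (u : R -> {ffun V -> R}) : Prop :=
  forall a b : R, a \in T -> b \in T -> a < b -> H1 w r `]a, b[ u.

Definition C0 (R : realType) (V : finType) (w : V -> V -> R) (r : R)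
    (T : interval R) (u : R -> {ffun V -> R}) : Prop :=
  forall t : R, t \in T -> vcvg w r u (within [set` T] (nbhs t)) (u t).

(* dudt represents the a.e. defined weak derivative du/dt on all of T; it is
   obtained by gluing the weak derivatives on the subintervals ]a, b[. *)
Definition AC_solution (R : realType) (V : finType) (w : V -> V -> R)
    (r eps : R) (T : interval R) (u beta : R -> {ffun V -> R}) : Prop :=
  [/\ forall t, t \in T -> V01 (u t),
      H1loc w r T u,
      C0 w r T u
    & exists dudt : R -> {ffun V -> R},
        (forall a b : R, a \in T -> b \in T -> a < b ->
           L2 w r `]a, b[ dudt /\ weak_derivative `]a, b[ u dudt) /\
        {ae @lebesgue_measure R, forall t, t \in T ->
           eps *: dudt t + eps *: laplacian w r (u t)
             + (1 / 2) *: vone R V - u t = beta t /\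
           obstacle (u t) (beta t)}].

(* beta 0 is not constrained: the scheme only defines beta m for m >= 1. *)
Definition semi_discrete (R : realType) (V : finType) (w : V -> V -> R)
    (r eps tau : R) (u0 : {ffun V -> R}) (u beta : nat -> {ffun V -> R}) :
    Prop :=
  u 0%N = u0 /\
  forall n : nat,
    [/\ V01 (u n.+1),
        obstacle (u n.+1) (beta n.+1)
      & (1 - tau / eps) *: u n.+1 - heat w r tau (u n)
          + (tau / eps / 2) *: vone R V = (tau / eps) *: beta n.+1].

(* The step index, the ceiling of t / tau; absz is harmless for 0 <= t. *)
Definition step_index (R : realType) (tau t : R) : nat :=
  absz (Num.ceil (t / tau)).

(* Main.v *)
Require Import Defs.
From HB Require Import structures.
From mathcomp Require Import all_boot all_order all_algebra.
From mathcomp Require Import all_classical all_reals all_analysis.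
From mathcomp Require Import measurable_realfun function_spaces.
From mathcomp Require Import ring lra.

(** The whole sequence of schemes converges, without any extraction: the
    iterates at every time, with an error of order tau, and the reactions at
    almost every time.  The convergence of the means in the statement then
    comes from Cesaro's theorem.

    Write F(u) = u - 1/2 - eps Delta u for the drift.  The flow solves
    eps u' = F(u) + beta, and since exp(- tau Delta) = 1 - tau Delta + O(tau^2)
    one step of the scheme satisfies
    (1 - tau/eps) (u_(n+1) - u_n) = (tau/eps) (F(u_n) + beta_(n+1) + O(tau)),
    where in both cases the reaction beta can only push a coordinate away from
    the obstacle 0 or 1 that it touches (scheme_bounds, AC_growth, AC_decay).

    The iterates.  In the maximum norm, compare one coordinate of the scheme
    with the flow over one step.  If the iterate ends above the flow, it is not
    at 0, so its reaction is nonpositive; and unless the flow touches 1 during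
    the step, the reaction of the flow is nonnegative.  So the error only grows
    through the difference of the Lipschitz drifts.  If the flow touches 1,
    then it is within O(tau) of 1, and the iterate is at most 1.  A discrete
    Gronwall argument gives an error O(tau) on bounded intervals
    (scheme_error).

    The reactions.  The flow is a primitive of its weak derivative
    (weak_primitive), hence differentiable almost everywhere; where a
    coordinate is 0 or 1 it has an extremum, so its derivative is 0 and its
    reaction is - F (AC_contact).  Fix such a time t and a coordinate that is 0
    there; then F <= 0.  If F = 0, the balance of the step squeezes the reaction
    of the scheme between 0 and - F + o(1).  If F < 0, the iterates are pushed
    towards 0 at a fixed rate during an interval [t - d, t], and start it at
    height o(d) + O(tau) because the flow has derivative 0 at t; so they have
    reached 0 before t (contact_vanish), the step is stationary, and its balance
    gives the reaction - F + O(tau) (contact_force).  The obstacle 1 is the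
    mirror image, and strictly between the obstacles both reactions vanish. *)

Set Implicit Arguments.
Unset Strict Implicit.
Unset Printing Implicit Defensive.

Import Order.TTheory GRing.Theory Num.Theory.
Import numFieldNormedType.Exports.

Local Open Scope classical_set_scope.
Local Open Scope ring_scope.

(** * Smooth functions and a smooth step *)

Section smooth.
Context {R : realType}.
Implicit Types (f g df : R -> R) (n k : nat) (x : R).

(** A recursive form of n-fold differentiability, in which the rules for sums,
    products and inverses go through by induction on n. *)
Fixpoint differentiable_upto n f : Prop :=
  if n is n'.+1 then
    (forall x, derivable f x 1) /\ differentiable_upto n' (derive1 f)
  else True.

Definition smooth f := forall n, differentiable_upto n f.

Lemma smooth_derivable f : smooth f -> forall n x, derivable (derive1n n f) x 1.
Proof.
move=> sf n; elim: n f sf => [|n IH] f sf x; first exact: (sf 1%N).1.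
rewrite derive1Sn; apply: IH => m; exact: (sf m.+1).2.
Qed.

Lemma differentiable_uptoSI n f df :
  (forall x, is_derive x 1 f (df x)) -> differentiable_upto n df ->
  differentiable_upto n.+1 f.
Proof.
move=> fdf sdf; split => [x|]; first exact: (fdf x).(ex_derive).
by rewrite (_ : derive1 f = df)//; apply/funext => x; rewrite derive1E derive_val.
Qed.

Lemma differentiable_uptoE n f : differentiable_upto n.+1 f ->
  (forall x, is_derive x 1 f (derive1 f x)) /\ differentiable_upto n (derive1 f).
Proof.
by move=> [df sdf]; split => // x; rewrite derive1E; exact: derivableP.
Qed.

Lemma differentiable_uptoW n f :
  differentiable_upto n.+1 f -> differentiable_upto n f.
Proof.
by elim: n f => [//|n IH] f [df sdf]; split => //; exact: IH.
Qed.

Lemma differentiable_upto_cst n (a : R) : differentiable_upto n (cst a).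
Proof.
elim: n a => [//|n IH] a.
by apply: (differentiable_uptoSI (df := cst 0)) => // x; exact: is_derive_cst.
Qed.

(** This rule and the next ones are pointwise forms of the rules for sums,
    products, inverses and powers, so that derivatives of lambda terms can be
    computed by composing them. *)
Lemma is_derive_addf f g x (a b : R) : is_derive x 1 f a -> is_derive x 1 g b ->
  is_derive x 1 (fun y => f y + g y) (a + b).
Proof. exact: is_deriveD. Qed.

Lemma is_derive_mulf f g x (a b : R) : is_derive x 1 f a -> is_derive x 1 g b ->
  is_derive x 1 (fun y => f y * g y) (f x * b + g x * a).
Proof. exact: is_deriveM. Qed.

Lemma is_derive_invf f x (a : R) : f x != 0 -> is_derive x 1 f a ->
  is_derive x 1 (fun y => (f y)^-1) (- a * ((f x)^-1 * (f x)^-1)).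
Proof.
move=> fx0 fa; have := is_deriveV fx0 fa.
by rewrite /GRing.scale/= expr2 invfM mulNr mulrC mulNr.
Qed.

Lemma is_derive_expf f k x (a : R) : is_derive x 1 f a ->
  is_derive x 1 (fun y => f y ^+ k) (k%:R * f x ^+ k.-1 * a).
Proof.
move=> fa; rewrite (_ : (fun y => _) = f ^+ k); last first.
  by apply/funext => y; rewrite exprfctE.
exact: is_deriveX.
Qed.

Lemma is_derive_affine f df (a b x : R) :
  (forall y : R, is_derive y 1 f (df y)) ->
  is_derive x 1 (fun y => f (a * y + b)) (a * df (a * x + b)).
Proof.
move=> fdf; rewrite [a * df _]mulrC.
apply: (@is_derive1_comp _ f (fun y : R => a * y + b) x _ _ (fdf _)).
have := is_derive_addf (is_derive_mulf
  (@is_derive_cst R R R a x 1) (@is_derive_id R R x 1))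
  (@is_derive_cst R R R b x 1).
by rewrite mulr1 mulr0 !addr0.
Qed.

Lemma differentiable_uptoD n f g : differentiable_upto n f ->
  differentiable_upto n g -> differentiable_upto n (fun x => f x + g x).
Proof.
elim: n f g => [//|n IH] f g /differentiable_uptoE[df sdf].
move=> /differentiable_uptoE[dg sdg].
exact: differentiable_uptoSI (fun x => is_derive_addf (df x) (dg x))
  (IH _ _ sdf sdg).
Qed.

Lemma differentiable_uptoM n f g : differentiable_upto n f ->
  differentiable_upto n g -> differentiable_upto n (fun x => f x * g x).
Proof.
elim: n f g => [//|n IH] f g sf sg.
have [df sdf] := differentiable_uptoE sf.
have [dg sdg] := differentiable_uptoE sg.
apply: (differentiable_uptoSI (fun x => is_derive_mulf (df x) (dg x))).
by apply: differentiable_uptoD; apply: IH => //; exact: differentiable_uptoW.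
Qed.

Lemma differentiable_uptoV n f : (forall x, f x != 0) ->
  differentiable_upto n f -> differentiable_upto n (fun x => (f x)^-1).
Proof.
move=> f0; elim: n => [//|n IH] sf.
have [df sdf] := differentiable_uptoE sf.
have iV := IH (differentiable_uptoW sf).
apply: (differentiable_uptoSI (fun x => is_derive_invf (f0 x) (df x))).
apply: differentiable_uptoM; last exact: differentiable_uptoM.
under eq_fun do rewrite -mulN1r.
by apply: differentiable_uptoM => //; exact: differentiable_upto_cst.
Qed.

Lemma differentiable_upto_affine n f (a b : R) : differentiable_upto n f ->
  differentiable_upto n (fun x => f (a * x + b)).
Proof.
elim: n f => [//|n IH] f /differentiable_uptoE[df sdf].
apply: (differentiable_uptoSI (fun x => is_derive_affine a b x df)).
by apply: differentiable_uptoM (IH _ sdf); exact: differentiable_upto_cst.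
Qed.

(** The functions x^-k exp(-1/x), extended by 0 to x <= 0. All of them are
    needed at once, because differentiating one gives a combination of two
    others. *)
Definition flat k x : R := if 0 < x then x^-1 ^+ k * expR (- x^-1) else 0.

Lemma flat_le0 k x : x <= 0 -> flat k x = 0.
Proof. by rewrite /flat ltNge => ->. Qed.

Lemma flat_gt0 k x : 0 < x -> 0 < flat k x.
Proof.
by move=> x0; rewrite /flat x0 mulr_gt0 ?expR_gt0// exprn_gt0 ?invr_gt0.
Qed.

Lemma flat_ge0 k x : 0 <= flat k x.
Proof. by have [/(flat_gt0 k)/ltW//|/(flat_le0 k)->] := ltP 0 x. Qed.

(** The exponential series bounds y^k exp(-y) by (k+1)! / y; here y = 1/x. The
    linear bound in x is what makes the derivative at 0 vanish. *)
Lemma flat_le k x : flat k x <= k.+1`!%:R * `|x|.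
Proof.
have [x0|x0] := ltP 0 x; last by rewrite flat_le0// mulr_ge0.
rewrite /flat x0 expRN gtr0_norm// ler_pdivrMr ?expR_gt0//.
have y0 : 0 < x^-1 by rewrite invr_gt0.
have /(ler_wpM2l (ltW x0)) : x^-1 ^+ k.+1 / k.+1`!%:R <= expR x^-1.
  by apply: le_trans (expR_ge1Dxn k (ltW y0)); rewrite lerDr.
rewrite exprS !mulrA divff ?gt_eqF// mul1r ler_pdivrMr ?ltr0n ?fact_gt0//.
by move/le_trans; apply; rewrite le_eqVlt; apply/orP; left; apply/eqP; ring.
Qed.

Lemma is_derive_flat k x :
  is_derive x 1 (flat k) (flat k.+2 x - k%:R * flat k.+1 x).
Proof.
have [x0|x0|<-] := ltgtP 0 x.
- apply: (@near_eq_is_derive R R R (fun y : R => y^-1 ^+ k * expR (- y^-1))).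
  + near=> y; rewrite /flat ifT//; near: y.
    exact: lt_nbhsr.
  + have xn0 : x != 0 by rewrite gt_eqF.
    have dV := is_derive_invf xn0 (@is_derive_id R R x 1).
    have dE : is_derive x 1 (fun y : R => expR (- y^-1))
        (expR (- x^-1) * x ^- 2).
      apply: (@is_derive1_comp _ expR (fun y : R => - y^-1) x).
      have := is_deriveN dV.
      by rewrite mulN1r opprK -expr2 exprVn.
    apply: (is_derive_eq (is_derive_mulf (is_derive_expf k dV) dE)).
    rewrite /flat x0 -exprVn; set y := x^-1; set e := expR _.
    by case: k => [|k] /=; rewrite ?exprS -?natr1; ring.
- apply: (@near_eq_is_derive R R R (fun=> 0 : R)).
  + near=> y; rewrite /flat ifF//; apply/negbTE; rewrite -leNgt ltW//.
    by near: y; exact: lt_nbhsl.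
  + by rewrite !flat_le0 ?ltW// mulr0 subr0; exact: is_derive_cst.
- rewrite !flat_le0 // mulr0 subr0.
  have H : (fun h : R => h^-1 *: (flat k (h *: 1 + 0) - flat k 0)) @ 0^' -->
      (0 : R).
    rewrite [X in X @ _](_ : _ = flat k.+1); last first.
      apply/funext => h; rewrite (@flat_le0 k 0)// subr0 addr0 /GRing.scale/= mulr1.
      have [h0|h0] := ltP 0 h; last by rewrite !flat_le0// mulr0.
      by rewrite /flat h0 exprS mulrA.
    apply/cvgr0Pnorm_le => /= e e0.
    have c0 : 0 < k.+2`!%:R :> R by rewrite ltr0n fact_gt0.
    near=> h; rewrite ger0_norm ?flat_ge0//; apply: le_trans (flat_le _ _) _.
    rewrite mulrC -ler_pdivlMr//; near: h.
    by apply: dnbhs0_le; rewrite divr_gt0.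
  by apply: DeriveDef; [apply/cvg_ex; exists 0|exact/cvg_lim].
Unshelve. all: by end_near. Qed.

Lemma smooth_flat k : smooth (flat k).
Proof.
move=> n; elim: n k => [//|n IH] k.
apply: differentiable_uptoSI; first exact: is_derive_flat.
apply: differentiable_uptoD => //.
under eq_fun do rewrite -mulNr.
by apply: differentiable_uptoM => //; exact: differentiable_upto_cst.
Qed.

(** The usual smooth transition from 0 on x <= 0 to 1 on x >= 1. *)
Definition step x : R := flat 0 x / (flat 0 x + flat 0 (1 - x)).

Let den_gt0 x : 0 < flat 0 x + flat 0 (1 - x).
Proof.
have [x0|x0] := ltP 0 x; first by rewrite ltr_pwDl ?flat_gt0 ?flat_ge0.
by rewrite ltr_wpDl ?flat_ge0// flat_gt0// subr_gt0 (le_lt_trans x0).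
Qed.

Lemma step_le0 x : x <= 0 -> step x = 0.
Proof. by move=> x0; rewrite /step flat_le0// mul0r. Qed.

Lemma step_ge1 x : 1 <= x -> step x = 1.
Proof.
move=> x1; have := den_gt0 x; rewrite /step [flat 0 (1 - x)]flat_le0 ?subr_le0//.
by rewrite addr0 => x0; rewrite divff ?gt_eqF.
Qed.

Lemma step_ge0 x : 0 <= step x.
Proof. by rewrite divr_ge0 ?flat_ge0// ltW// den_gt0. Qed.

Lemma step_le1 x : step x <= 1.
Proof. by rewrite ler_pdivrMr ?den_gt0// mul1r lerDl flat_ge0. Qed.

Let subr1E : (fun x : R => flat 0 (1 - x)) = (fun x => flat 0 ((- 1) * x + 1)).
Proof. by apply/funext => x; rewrite mulN1r addrC. Qed.

Lemma smooth_step : smooth step.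
Proof.
move=> n; apply: differentiable_uptoM; first exact: smooth_flat.
apply: differentiable_uptoV => [x|]; first by rewrite gt_eqF.
apply: differentiable_uptoD; first exact: smooth_flat.
rewrite subr1E; apply: differentiable_upto_affine; exact: smooth_flat.
Qed.

Lemma derive1_stepE x : derive1 step x =
  (flat 2 x * flat 0 (1 - x) + flat 0 x * flat 2 (1 - x)) /
  (flat 0 x + flat 0 (1 - x)) ^+ 2.
Proof.
have df (y : R) : is_derive y 1 (flat 0) (flat 2 y).
  by have := is_derive_flat 0 y; rewrite mul0r subr0.
have dg : is_derive x 1 (fun x => flat 0 (1 - x)) (- flat 2 (1 - x)).
  rewrite subr1E; have := is_derive_affine (- 1) 1 x df.
  by rewrite !mulN1r [- x + 1]addrC.
have dn0 : flat 0 x + flat 0 (1 - x) != 0 by rewrite gt_eqF.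
have dV := @is_derive_invf (fun y => flat 0 y + flat 0 (1 - y)) x _ dn0
  (is_derive_addf (df x) dg).
have h := is_derive_mulf (df x) dV.
by rewrite derive1E (@derive_val _ _ _ _ _ _ _ h); field.
Qed.

Lemma derive1_step_ge0 x : 0 <= derive1 step x.
Proof.
by rewrite derive1_stepE divr_ge0 ?sqr_ge0// addr_ge0// mulr_ge0 ?flat_ge0.
Qed.

Lemma derive1_step_eq0 x : ~~ (0 < x < 1) -> derive1 step x = 0.
Proof.
rewrite derive1_stepE negb_and -!leNgt => /orP[x0|x1].
  by rewrite ![flat _ x]flat_le0// !mul0r addr0 mul0r.
by rewrite ![flat _ (1 - x)]flat_le0 ?subr_le0// !mulr0 addr0 mul0r.
Qed.

End smooth.

(** * A continuous function is a primitive of its weak derivative *)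

Section weak_primitive.
Context {R : realType}.
Notation mu := (@lebesgue_measure R).
Implicit Types (f g v : R -> R) (a b c l s t x : R).

(** For large l this is a smooth approximation of the indicator of x > c, with
    its whole transition inside [c, c + 1/l]. *)
Definition ramp (l c : R) : R -> R := fun x => step (l * x + - (l * c)).

Lemma ramp_ge0_le1 l c x : 0 <= ramp l c x <= 1.
Proof. by rewrite /ramp step_ge0 step_le1. Qed.

Lemma is_derive_ramp l c x :
  is_derive x 1 (ramp l c) (l * derive1 step (l * x + - (l * c))).
Proof.
apply: is_derive_affine => y.
by have [] := differentiable_uptoE (@smooth_step R 1%N).
Qed.

Lemma smooth_ramp l c : smooth (ramp l c).
Proof. by move=> n; apply: differentiable_upto_affine; exact: smooth_step. Qed.

Lemma derive1_rampE l c x :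
  derive1 (ramp l c) x = l * derive1 step (l * x + - (l * c)).
Proof.
by rewrite derive1E (@derive_val _ _ _ _ _ _ _ (is_derive_ramp l c x)).
Qed.

Lemma smooth_continuous f : smooth f -> continuous f.
Proof.
by move=> sf x; apply/differentiable_continuous/derivable1_diffP; exact: (sf 1%N).1.
Qed.

Lemma smooth_derive1 f : smooth f -> smooth (derive1 f).
Proof. by move=> sf n; exact: (sf n.+1).2. Qed.

Lemma integrableZlR (D : set R) f (k : R) : measurable D ->
  mu.-integrable D (EFin \o f) -> mu.-integrable D (EFin \o (fun x => k * f x)).
Proof. by move=> mD fi; apply: (@integrableZl _ _ _ mu _ mD k (EFin \o f)). Qed.

Lemma integrableBR (D : set R) f g : measurable D ->
  mu.-integrable D (EFin \o f) -> mu.-integrable D (EFin \o g) ->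
  mu.-integrable D (EFin \o (fun x => f x - g x)).
Proof.
by move=> mD fi gi; apply: (@integrableB _ _ _ mu _ mD (EFin \o f) (EFin \o g)).
Qed.

Lemma integrable_cst_oo (s t m : R) : mu.-integrable `]s, t[ (EFin \o (fun=> m)).
Proof.
have : mu.-integrable `[s, t] (EFin \o (fun=> m)).
  apply: continuous_compact_integrable; first exact: segment_compact.
  by apply: continuous_subspaceT => x; exact: cvg_cst.
by apply: integrableS => //; exact: subset_itv_oo_cc.
Qed.

(** The derivative of a ramp is nonnegative, has integral 1 and lives on [c, c
    + 1/l], so integrating g against it averages g over that interval. *)
Lemma ramp_mean g (a b c l e : R) : 0 < l -> a < c -> c + l^-1 < b ->
  measurable_fun `]a, b[ g -> (forall x, `]a, b[%classic x -> `|g x| <= 1) ->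
  (forall x, c < x < c + l^-1 -> `|g x - g c| <= e) ->
  mu.-integrable `]a, b[ (EFin \o (fun x => g x * derive1 (ramp l c) x)) /\
  `|\int[mu]_(x in `]a, b[) (g x * derive1 (ramp l c) x) - g c| <= e.
Proof.
move=> l0 ac cb mg g1 ge.
have cbl : c < c + l^-1 by rewrite ltrDl invr_gt0.
have ab : a < b by rewrite (lt_trans ac)// (lt_trans _ cb).
set D := derive1 (ramp l c).
have Dc : continuous D by apply/smooth_continuous/smooth_derive1/smooth_ramp.
have D0 x : 0 <= D x by rewrite /D derive1_rampE mulr_ge0 ?derive1_step_ge0 ?ltW.
have iDc : mu.-integrable `[a, b] (EFin \o D).
  apply: continuous_compact_integrable; first exact: segment_compact.
  by apply: continuous_subspaceT.
have iD : mu.-integrable `]a, b[ (EFin \o D).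
  by apply: integrableS iDc => //; exact: subset_itv_oo_cc.
have mD : measurable_fun `]a, b[ D by apply/measurable_EFinP; case/integrableP: iD.
have igD : mu.-integrable `]a, b[ (EFin \o (fun x => g x * D x)).
  apply: le_integrable iD => //.
    by apply/measurable_EFinP; exact: measurable_funM.
  move=> x /= xab; rewrite lee_fin normrM ler_piMl//; exact: g1.
split; first exact: igD.
have D1 : \int[mu]_(x in `]a, b[) D x = 1.
  rewrite Rintegral_itv_bndo_bndc//.
  rewrite Rintegral_itv_obnd_cbnd; last first.
    by apply: integrableS iDc => //; exact: subset_itv_oc_cc.
  rewrite /Rintegral (@continuous_FTC2 _ _ (ramp l c))//.
  - rewrite /= /ramp step_ge1 ?step_le0 ?subr0//.
      by rewrite -mulrBr mulr_ge0_le0 ?subr_le0 ?ltW.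
    by rewrite -mulrBr -ler_pdivrMl// mulr1 lerBrDl ltW.
  - by apply: continuous_subspaceT.
  - split => [x _||].
    + exact: (is_derive_ramp l c x).(ex_derive).
    + by apply: cvg_at_right_filter; apply/smooth_continuous/smooth_ramp.
    + by apply: cvg_at_left_filter; apply/smooth_continuous/smooth_ramp.
(* D is a probability density, so g c and e may be moved under the integral. *)
have -> : g c = \int[mu]_(x in `]a, b[) (g c * D x).
  by rewrite RintegralZl// D1 mulr1.
have igc : mu.-integrable `]a, b[ (EFin \o (fun x => g c * D x)).
  exact: integrableZlR.
rewrite -RintegralB//.
have iB : mu.-integrable `]a, b[ (EFin \o (fun x => g x * D x - g c * D x)).
  exact: integrableBR.
apply: le_trans (le_normr_Rintegral _ iB) _ => //.
have -> : e = \int[mu]_(x in `]a, b[) (e * D x) by rewrite RintegralZl// D1 mulr1.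
apply: le_Rintegral => //.
- by apply/integrable_norm.
- exact: integrableZlR.
- move=> x xab; rewrite -mulrBl normrM (ger0_norm (D0 x)).
  have [/ge h|nx] := boolP (c < x < c + l^-1); first exact: ler_wpM2r.
  rewrite /D derive1_rampE derive1_step_eq0 ?mulr0//.
  apply: contra nx => /andP[]; rewrite -mulrBr pmulr_rgt0// subr_gt0 => ->/=.
  by rewrite -ltr_pdivlMl// mulr1 ltrBlDl.
Qed.

Lemma derive1_rampB l s t x :
  derive1 (fun x => ramp l s x - ramp l t x) x =
  derive1 (ramp l s) x - derive1 (ramp l t) x.
Proof.
rewrite !derive1_rampE derive1E.
exact: (@derive_val _ _ _ _ _ _ _
  (is_deriveB (is_derive_ramp l s x) (is_derive_ramp l t x))).
Qed.

Lemma test_function_rampB a b s t l : 0 < l -> a < s -> s < t -> t + l^-1 < b ->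
  test_function `]a, b[ (fun x => ramp l s x - ramp l t x).
Proof.
move=> l0 ha st tb; split.
  apply: smooth_derivable => n; apply: differentiable_uptoD.
    exact: smooth_ramp.
  under eq_fun do rewrite -mulN1r.
  apply: differentiable_uptoM; first exact: differentiable_upto_cst.
  exact: smooth_ramp.
exists `[s, t + l^-1]%classic; split.
- exact: segment_compact.
- move=> x /=; rewrite !in_itv/= => /andP[sx xt].
  by rewrite (lt_le_trans ha sx)/= (le_lt_trans xt).
- move=> x /= /negP; rewrite in_itv/= negb_and -!ltNge /ramp -!mulrBr.
  case/orP => h.
    by rewrite !step_le0 ?subrr// pmulr_rle0// subr_le0 ltW// (lt_trans h).
  have lx : 1 <= l * (x - t).
    by rewrite -ler_pdivrMl// mulr1 lerBrDl ltW.
  by rewrite !step_ge1 ?subrr// (le_trans lx)// ler_wpM2l ?ltW// ltrD2l ltrN2.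
Qed.

Lemma cvg_rampB s t x : s < t ->
  (fun k : nat => ramp k.+1%:R s x - ramp k.+1%:R t x) @ \oo -->
  (\1_`]s, t] x : R).
Proof.
have ramp_cvg c :
    (fun k : nat => ramp k.+1%:R c x) @ \oo --> ((c < x)%R%:R : R).
  have [cx|xc] := ltP c x; last first.
    rewrite (_ : (fun _ => _) = fun=> 0); first exact: cvg_cst.
    apply/funext => k; rewrite /ramp -mulrBr step_le0//.
    by rewrite pmulr_rle0// subr_le0.
  apply: cvg_near_cst; near=> k.
  rewrite /ramp -mulrBr step_ge1// -ler_pdivrMr ?subr_gt0// mul1r.
  rewrite (@le_trans _ _ k%:R) ?ler_nat//.
  by apply: ltW; near: k; exact: nbhs_infty_gtr.
move=> st.
rewrite (_ : \1_`]s, t] x = (s < x)%R%:R - (t < x)%R%:R :> R); first exact: cvgB.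
rewrite indicE mem_setE in_itv/=.
have [sx|xs] := ltP s x; have [xt|tx] := leP x t => //=; rewrite ?subr0 ?subrr//.
by have := lt_trans st (lt_le_trans tx xs); rewrite ltxx.
Unshelve. all: by end_near. Qed.

(** Dominated convergence: the difference of two ramps tends to the indicator
    of ]s, t]. *)
Lemma cvg_Rintegral_ramp a b v s t : mu.-integrable `]a, b[ (EFin \o v) ->
  a < s -> s < t -> t < b ->
  (fun k : nat => \int[mu]_(x in `]a, b[)
     (v x * (ramp k.+1%:R s x - ramp k.+1%:R t x))) @ \oo -->
  \int[mu]_(x in `]s, t]) v x.
Proof.
move=> iv ha st tb.
have mv : measurable_fun `]a, b[ v by apply/measurable_EFinP; case/integrableP: iv.
have sub : `]s, t]%classic `<=` `]a, b[%classic.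
  move=> x /=; rewrite !in_itv/= => /andP[sx xt].
  by rewrite (lt_trans ha sx)/= (le_lt_trans xt).
have -> : \int[mu]_(x in `]s, t]) v x =
    \int[mu]_(x in `]a, b[) (v x * \1_`]s, t] x).
  rewrite -{1}(setIidr sub) Rintegral_mkcondr; apply: eq_Rintegral => x _.
  by rewrite patchE indicE; case: (x \in _); rewrite ?mulr1 ?mulr0.
have mphi k : measurable_fun `]a, b[ (fun x => v x * (ramp k s x - ramp k t x)).
  apply: measurable_funM => //; apply: measurable_funB;
    by apply: measurable_funTS; apply: continuous_measurable_fun;
      exact/smooth_continuous/smooth_ramp.
have := @dominated_convergence _ _ _ mu `]a, b[%classic (measurable_itv _)
  (fun k x => (v x * (ramp k.+1%:R s x - ramp k.+1%:R t x))%:E)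
  (fun x => (v x * \1_`]s, t] x)%:E) (fun x => `|v x|%:E).
case.
- by move=> k; apply/measurable_EFinP; exact: mphi.
- apply/measurable_EFinP; exact: measurable_funM.
- apply: aeW => x _; apply: cvg_EFin; first exact: nearW.
  by apply: cvgM; [exact: cvg_cst|exact: cvg_rampB].
- exact: integrable_norm.
- apply: aeW => x k _; rewrite lee_fin normrM ler_piMr// ler_norml.
  have := ramp_ge0_le1 k.+1%:R s x; have := ramp_ge0_le1 k.+1%:R t x; lra.
move=> ilim _ clim; apply: fine_cvg; rewrite fineK//.
exact: integrable_fin_num.
Qed.

Let dist_sub_half (p q x y e : R) :
  `|p - x| <= e / 2 -> `|q - y| <= e / 2 -> `|x - y - (p - q)| <= e.
Proof. rewrite !ler_norml; lra. Qed.

Lemma cvg_Rintegral_deriv_ramp a b g s t : measurable_fun `]a, b[ g ->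
  (forall x, `]a, b[%classic x -> `|g x| <= 1) ->
  {in `]a, b[, continuous g} ->
  a < s -> s < t -> t < b ->
  (fun k : nat => \int[mu]_(x in `]a, b[)
     (g x * derive1 (fun x => ramp k.+1%:R s x - ramp k.+1%:R t x) x)) @ \oo -->
  g s - g t.
Proof.
move=> mg g1 cg ha st tb; have sb := lt_trans st tb; have at_ := lt_trans ha st.
apply/cvgrPdist_le => e e0.
have e20 : 0 < e / 2 by rewrite divr_gt0.
pose mean_close c k :=
  mu.-integrable `]a, b[ (EFin \o (fun x => g x * derive1 (ramp k.+1%:R c) x)) /\
  `|\int[mu]_(x in `]a, b[) (g x * derive1 (ramp k.+1%:R c) x) - g c| <= e / 2.
have mean c : a < c -> c < b -> \forall k \near \oo, mean_close c k.
  move=> ac cb.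
  have bc0 : 0 < b - c by rewrite subr_gt0.
  have /cg/cvgrPdist_le/(_ _ e20) : c \in `]a, b[ by rewrite in_itv/= ac.
  move=> /nbhs_ballP[d /= d0 gd].
  near=> k.
  have kd : k.+1%:R^-1 < d.
    by near: k; exact: (near_infty_natSinv_lt (PosNum d0)).
  have kb : c + k.+1%:R^-1 < b.
    by rewrite -ltrBrDl; near: k; exact: (near_infty_natSinv_lt (PosNum bc0)).
  apply: ramp_mean => // x /andP[cx xc].
  rewrite distrC; apply: gd; rewrite /ball/= distrC gtr0_norm ?subr_gt0//.
  by rewrite ltrBlDl (lt_trans xc)// ltrD2l.
near=> k.
have [is_ ms] : mean_close s k by near: k; exact: mean.
have [it mt] : mean_close t k by near: k; exact: mean.
under eq_Rintegral do rewrite derive1_rampB mulrBr.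
by rewrite RintegralB//; exact: dist_sub_half.
Unshelve. all: by end_near. Qed.

(** Test the weak derivative against the smooth approximations of the
    indicator of ]s, t]: on one side the derivatives of the two ramps pick out
    g s and g t, on the other side the integral of v over ]s, t] appears. *)
Theorem weak_primitive a b g v : measurable_fun `]a, b[ g ->
  (forall x, `]a, b[%classic x -> `|g x| <= 1) ->
  {in `]a, b[, continuous g} ->
  mu.-integrable `]a, b[ (EFin \o v) ->
  (forall phi, test_function `]a, b[ phi ->
     \int[mu]_(x in `]a, b[) (g x * derive1 phi x) =
     - \int[mu]_(x in `]a, b[) (v x * phi x)) ->
  forall s t, a < s -> s < t -> t < b ->
  g t - g s = \int[mu]_(x in `]s, t]) v x.
Proof.
move=> mg g1 cg iv wd s t ha st tb.
have cL := cvg_Rintegral_deriv_ramp mg g1 cg ha st tb.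
have /cvgN cR := cvg_Rintegral_ramp iv ha st tb.
rewrite -[LHS]opprB -[RHS]opprK; congr (- _).
rewrite -(cvg_lim (@Rhausdorff R) cL).
apply: cvg_lim; first exact: Rhausdorff.
apply: cvg_trans cR; apply: near_eq_cvg.
have bt0 : 0 < b - t by rewrite subr_gt0.
near=> k => /=; rewrite wd//; apply: test_function_rampB => //.
by rewrite -ltrBrDl; near: k; exact: (near_infty_natSinv_lt (PosNum bt0)).
Unshelve. all: by end_near. Qed.

End weak_primitive.

(** * The norm and the coordinates *)

Section norm.
Context {R : realType} {V : finType}.
Variables (w : V -> V -> R) (r : R).
Hypothesis degree_gt0 : forall i, 0 < degree w i.
Implicit Types (u v : {ffun V -> R}) (i : V).

Lemma vdot_ge u i : u i ^+ 2 * degree w i `^ r <= vdot w r u u.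
Proof.
rewrite /vdot (bigD1 i)//= -expr2 lerDl sumr_ge0// => j _.
by rewrite -expr2 mulr_ge0 ?sqr_ge0// powR_ge0.
Qed.

Lemma vdot_ge0 u : 0 <= vdot w r u u.
Proof.
by apply: sumr_ge0 => i _; rewrite -expr2 mulr_ge0 ?sqr_ge0// powR_ge0.
Qed.

Lemma vnorm_sqr u : vnorm w r u ^+ 2 = vdot w r u u.
Proof. by rewrite sqr_sqrtr// vdot_ge0. Qed.

(** Positive degrees make every coordinate controlled by the norm, so that
    convergence in norm is convergence of coordinates. *)
Lemma coord_le_vnorm u i : `|u i| <= vnorm w r u / Num.sqrt (degree w i `^ r).
Proof.
rewrite ler_pdivlMr ?sqrtr_gt0; last exact: powR_gt0.
rewrite -sqrtr_sqr -sqrtrM ?sqr_ge0// ler_wsqrtr//.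
exact: vdot_ge.
Qed.

Lemma vcvg_coord (I : Type) (f : I -> {ffun V -> R}) (F : set_system I)
    (l : {ffun V -> R}) :
  Filter F -> vcvg w r f F l -> forall i, f x i @[x --> F] --> l i.
Proof.
move=> FF fl i; apply/cvgrPdist_le => e e0.
have c0 : 0 < Num.sqrt (degree w i `^ r) by rewrite sqrtr_gt0 powR_gt0.
have /cvgrPdist_le/(_ _ (mulr_gt0 e0 c0)) := fl.
apply: filterS => x; rewrite sub0r normrN ger0_norm ?sqrtr_ge0// => h.
have := coord_le_vnorm (f x - l) i; rewrite !ffunE distrC => /le_trans; apply.
by rewrite ler_pdivrMr.
Qed.

Lemma coord_vcvg (I : Type) (f : I -> {ffun V -> R}) (F : set_system I)
    (l : {ffun V -> R}) :
  Filter F -> (forall i, f x i @[x --> F] --> l i) -> vcvg w r f F l.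
Proof.
move=> FF fl; rewrite /vcvg.
have -> : (0 : R) = Num.sqrt (\sum_(i : V) 0 * 0 * degree w i `^ r).
  by rewrite big1 ?sqrtr0// => i _; rewrite !mul0r.
apply: (@cvg_comp _ _ _ _ (@Num.sqrt R)); last exact: sqrt_continuous.
apply: (cvg_big add_continuous) => i _.
have h : (f x - l) i @[x --> F] --> (0 : R).
  under eq_fun do rewrite !ffunE.
  by rewrite -(subrr (l i)); apply: cvgB => //; exact: cvg_cst.
by apply: cvgM; [exact: cvgM|exact: cvg_cst].
Qed.

End norm.

(** * Almost everywhere statements on the line *)

Section ae.
Context {R : realType}.
Notation mu := (@lebesgue_measure R).

Lemma ae_imply (P Q : R -> Prop) : {ae mu, forall x, P x} ->
  (forall x, P x -> Q x) -> {ae mu, forall x, Q x}.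
Proof.
by move=> aP PQ; move: aP; apply: filterS;
  first exact: (ae_filter_ringOfSetsType mu).
Qed.

Lemma ae_imply2 (P Q S : R -> Prop) : {ae mu, forall x, P x} ->
  {ae mu, forall x, Q x} -> (forall x, P x -> Q x -> S x) ->
  {ae mu, forall x, S x}.
Proof.
by move=> aP aQ PQS; move: aP aQ; apply: filterS2;
  first exact: (ae_filter_ringOfSetsType mu).
Qed.

Lemma ae_all_nat (P : nat -> R -> Prop) :
  (forall n, {ae mu, forall x, P n x}) -> {ae mu, forall x, forall n, P n x}.
Proof. exact: ae_foralln. Qed.

(** The vertices are numbered, and the almost everywhere statements are then
    intersected over the natural numbers. *)
Lemma ae_all_fin (V : finType) (P : V -> R -> Prop) :
  (forall i, {ae mu, forall x, P i x}) -> {ae mu, forall x, forall i, P i x}.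
Proof.
move=> aP.
have := @ae_all_nat (fun n x => forall i, enum_rank i = n :> nat -> P i x).
move=> /(_ _)/ae_imply; apply => [n|x h i]; last exact: h.
have [/existsP[i /eqP ri]|/existsPn no] :=
  boolP [exists i : V, enum_rank i == n :> nat].
  apply: ae_imply (aP i) _ => x Pix j; rewrite -ri => /ord_inj/enum_rank_inj ->.
  exact: Pix.
by apply: aeW => x i ri; have := no i; rewrite ri eqxx.
Qed.

End ae.

(** * Primitives: differentiability almost everywhere and growth bounds *)

Section primitive.
Context {R : realType}.
Notation mu := (@lebesgue_measure R).
Variables g v : R -> R.
Hypothesis v_int : forall b : R, 0 < b -> mu.-integrable `]0, b[ (EFin \o v).
Hypothesis g_prim : forall s t : R, 0 < s -> s < t ->
  g t - g s = \int[mu]_(x in `]s, t]) v x.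

(** The Lebesgue differentiation theorem on the intervals ]1/(n+1), n+1[,
    which exhaust the half-line. *)
Lemma ae_is_derive_primitive :
  {ae mu, forall x : R, 0 < x -> is_derive x 1 g (v x)}.
Proof.
have key n : {ae mu, forall x : R,
    n.+1%:R^-1 < x -> x < n.+1%:R -> is_derive x 1 g (v x)}.
  pose b : R := n.+1%:R; pose s : R := n.+1%:R^-1.
  have b0 : 0 < b by rewrite ltr0n.
  have s0 : 0 < s by rewrite invr_gt0.
  pose f := v \_ `]0, b[.
  have fT : mu.-integrable setT (EFin \o f).
    by rewrite -restrict_EFin -integrable_mkcond//; exact: v_int.
  have fI y : mu.-integrable [set` Interval (BRight s) (BRight y)] (EFin \o f).
    by apply: integrableS fT.
  have floc : locally_integrable [set: R] f.
    by apply: integrable_locally => //; exact: v_int.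
  have := FTC1 fI floc.
  move=> /ae_imply; apply => x FTC sx xb.
  have [] := FTC; first by rewrite lte_fin.
  set F := fun y : R => \int[mu]_(t in [set` Interval (BRight s) (BRight y)]) f t.
  move=> dF F'x.
  have Fd : is_derive x 1 F (v x).
    apply: DeriveDef => //.
    by rewrite -derive1E F'x /f patchE mem_set//= in_itv/= xb (lt_trans s0).
  apply: (@near_eq_is_derive R R R (fun y => g s + F y)); last first.
    by have := is_deriveD (@is_derive_cst R R R (g s) x 1) Fd; rewrite add0r.
  near=> y.
  have sy : s < y by near: y; exact: lt_nbhsr.
  have yb : y < b by near: y; exact: lt_nbhsl.
  have -> : F y = \int[mu]_(x in `]s, y]) v x.
    apply: eq_Rintegral => z; rewrite inE/= in_itv/= => /andP[sz zy].
    by rewrite /f patchE mem_set//= in_itv/= (lt_trans s0 sz) (le_lt_trans zy).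
  by rewrite -g_prim// addrC subrK.
apply: ae_imply (ae_all_nat key) _ => x h x0.
have [n] : exists n : nat, x < n.+1%:R /\ n.+1%:R^-1 < x.
  exists (Num.truncn x + Num.truncn x^-1)%N; split.
    apply: lt_le_trans (truncnS_gt x) _.
    by rewrite ler_nat ltnS leq_addr.
  rewrite invf_plt ?posrE// ?ltr0n//.
  apply: lt_le_trans (truncnS_gt x^-1) _.
  by rewrite ler_nat ltnS leq_addl.
by case=> xn nx; exact: h nx xn.
Unshelve. all: by end_near. Qed.

Let primitive_ge_pos (s t m k : R) : 0 < s -> s < t ->
  {ae mu, forall x : R, s < x < t -> m <= k * v x} ->
  m * (t - s) <= k * (g t - g s).
Proof.
move=> s0 st mv; rewrite g_prim//.
have vI : mu.-integrable `]s, t] (EFin \o v).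
  apply: integrableS (v_int (ltr_wpDr ler01 (lt_trans s0 st))) => //.
  move=> x /=; rewrite !in_itv/= => /andP[sx xt].
  by rewrite (lt_trans s0)// (le_lt_trans xt)// ltrDl.
have vIo : mu.-integrable `]s, t[ (EFin \o v).
  by apply: integrableS vI => //; exact: subset_itv_oo_oc.
have mI := integrable_cst_oo s t m.
rewrite -Rintegral_itv_bndo_bndc// -RintegralZl// -subr_ge0.
have -> : m * (t - s) = \int[mu]_(x in `]s, t[) m.
  rewrite Rintegral_cst//=; rewrite lebesgue_measure_itv/= lte_fin st.
  by rewrite -EFinD.
have kvI := integrableZlR k (measurable_itv _) vIo.
rewrite -RintegralB//.
have vm := integrableBR (measurable_itv _) kvI mI.
have mvm : measurable_fun `]s, t[ (fun x => k * v x - m).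
  by apply/measurable_EFinP; case/integrableP: vm.
(* The integrand is nonnegative almost everywhere, hence almost everywhere
   equal to its absolute value. *)
rewrite (_ : \int[mu]_(x in _) _ = \int[mu]_(x in `]s, t[) `|k * v x - m|).
  exact: Rintegral_ge0.
congr fine; apply: ae_eq_integral => //; first exact/measurable_EFinP.
  by apply/measurable_EFinP; apply: measurableT_comp.
apply: ae_imply mv _ => x /= mvx; rewrite in_itv/= => /mvx h.
by rewrite ger0_norm// subr_ge0.
Qed.

Hypothesis g_right0 : g x @[x --> 0^'+] --> g 0.

(** The constant k allows bounds of either sign, and multiples of v, to be
    used in the same way. The case s = 0 follows from s > 0 by continuity of g
    at 0. *)
Lemma primitive_ge (s t m k : R) : 0 <= s -> s < t ->
  {ae mu, forall x : R, s < x < t -> m <= k * v x} ->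
  m * (t - s) <= k * (g t - g s).
Proof.
rewrite le_eqVlt => /predU1P[<-|s0]; last exact: primitive_ge_pos.
move=> t0 mv.
apply: (@ler_cvg_to _ (0^'+) _ _
  (fun s => m * (t - s)) (fun s => k * (g t - g s))).
- apply: cvgM; first exact: cvg_cst.
  apply: cvgB; first exact: cvg_cst.
  by apply: cvg_at_right_filter; exact: cvg_id.
- apply: cvgM; first exact: cvg_cst.
  by apply: cvgB => //; exact: cvg_cst.
near=> y; apply: primitive_ge_pos => //.
apply: ae_imply mv _ => x mvx /andP[yx xt]; apply: mvx.
by rewrite xt andbT; apply: lt_trans yx.
Unshelve. all: by end_near. Qed.

End primitive.

(** * Derivatives at local minima *)

Section derivative.
Context {R : realType}.
Implicit Types (g : R -> R) (x d : R).

Lemma is_derive_expansion g x d : is_derive x 1 g d ->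
  forall e, 0 < e -> exists2 h0, 0 < h0 &
    forall h, `|h| < h0 -> `|g (x + h) - g x - d * h| <= e * `|h|.
Proof.
move=> gd e e0.
have : (fun h : R => h^-1 *: (g (h *: 1 + x) - g x)) @ 0^' --> d.
  rewrite -(@derive_val _ _ _ _ _ _ _ gd).
  exact: (@ex_derive _ _ _ _ _ _ _ gd).
move=> /cvgrPdist_le/(_ _ e0).
rewrite near_withinE => /nbhs_ballP[h0 /= h00 H].
exists h0 => // h hh0; have [->|hn0] := eqVneq h 0.
  by rewrite addr0 subrr mulr0 subr0 normr0 mulr0.
have := H h; rewrite /ball/= sub0r normrN => /(_ hh0 hn0).
rewrite /GRing.scale/= mulr1 [h + x]addrC -(ler_pM2r (x := `|h|)) ?normr_gt0//.
by rewrite -normrM mulrBl mulrAC mulVf// mul1r distrC.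
Qed.

(** A nonzero derivative d would make g decrease in the direction - sg d. *)
Lemma is_derive_local_min g x d e : 0 < e ->
  (forall h, `|h| < e -> g x <= g (x + h)) -> is_derive x 1 g d -> d = 0.
Proof.
move=> e0 gmin gd; apply/eqP; apply: contraT => d0.
have d20 : 0 < `|d| / 2 by rewrite divr_gt0// normr_gt0.
have [h0 h00 H] := is_derive_expansion gd d20.
pose k := Num.min e h0 / 2.
have m0 : 0 < Num.min e h0 by rewrite lt_min e0.
have k0 : 0 < k by rewrite divr_gt0.
have km : k < Num.min e h0 by rewrite ltr_pdivrMr// ltr_pMr// ltr1n.
have [ke kh] : k < e /\ k < h0.
  by split; apply: lt_le_trans km _; rewrite ge_min lexx ?orbT.
pose h := - Num.sg d * k.
have hk : `|h| = k by rewrite normrM normrN normr_sg d0 mul1r gtr0_norm.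
have := gmin h; rewrite hk => /(_ ke) gx.
have := H h; rewrite hk => /(_ kh).
have -> : d * h = - (`|d| * k) by rewrite /h normrEsg; ring.
have dk0 : 0 < `|d| * k by rewrite mulr_gt0// normr_gt0.
rewrite ler_norml; lra.
Qed.

End derivative.

(** * The Laplacian and the drift *)

Section drift.
Context {R : realType} {V : finType}.
Variables (w : V -> V -> R) (r eps : R).
Hypothesis eps_gt0 : 0 < eps.
Implicit Types (u v : {ffun V -> R}) (i : V) (c : R).

(** A crude bound for the operator norm of the Laplacian in the maximum norm. *)
Definition laplacian_bound : R :=
  \sum_i degree w i `^ (- r) * \sum_j `|w i j| * 2.

Lemma laplacian_bound_ge0 : 0 <= laplacian_bound.
Proof.
by apply: sumr_ge0 => i _; rewrite mulr_ge0 ?powR_ge0// sumr_ge0.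
Qed.

Lemma laplacian_le u c : (forall j, `|u j| <= c) ->
  forall i, `|laplacian w r u i| <= laplacian_bound * c.
Proof.
move=> uc i; have c0 : 0 <= c by apply: le_trans (uc i).
rewrite ffunE normrM ger0_norm ?powR_ge0//.
apply: (@le_trans _ _ (degree w i `^ (- r) * (\sum_j `|w i j| * 2) * c)); last first.
  rewrite ler_wpM2r// /laplacian_bound [X in _ <= X](bigD1 i)//= lerDl.
  rewrite sumr_ge0// => k _.
  by rewrite mulr_ge0 ?powR_ge0// sumr_ge0.
rewrite -mulrA ler_wpM2l ?powR_ge0// mulr_suml; apply: le_trans (ler_norm_sum _ _ _) _.
apply: ler_sum => j _; rewrite normrM -mulrA ler_wpM2l//.
by apply: le_trans (ler_normB _ _) _; rewrite mulr_natl mulr2n lerD.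
Qed.

Lemma laplacianB u v i :
  laplacian w r (u - v) i = laplacian w r u i - laplacian w r v i.
Proof.
rewrite !ffunE -mulrBr -sumrB; congr (_ * _); apply: eq_bigr => j _.
by rewrite !ffunE; ring.
Qed.

(** The flow equation reads eps u' = drift u + beta. *)
Definition drift u i : R := u i - 1 / 2 - eps * laplacian w r u i.

Definition drift_lip : R := 1 + eps * laplacian_bound.

Lemma drift_lip_ge1 : 1 <= drift_lip.
Proof. by rewrite lerDl mulr_ge0 ?laplacian_bound_ge0// ltW. Qed.

Lemma drift_lipschitz u v c : (forall j, `|u j - v j| <= c) ->
  forall i, `|drift u i - drift v i| <= drift_lip * c.
Proof.
move=> uvc i.
have -> : drift u i - drift v i = (u i - v i) - eps * laplacian w r (u - v) i.
  by rewrite laplacianB /drift; ring.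
apply: le_trans (ler_normB _ _) _; rewrite mulrDl mul1r lerD//.
rewrite normrM gtr0_norm// -mulrA ler_wpM2l ?(ltW eps_gt0)// laplacian_le// => j.
by rewrite !ffunE.
Qed.

Lemma drift_le u i : V01 u -> `|drift u i| <= drift_lip + 1 / 2.
Proof.
move=> u01.
have h0 j : `|u j - (0 : {ffun V -> R}) j| <= 1.
  rewrite ffunE subr0; have := u01 j; rewrite /= in_itv/= => /andP[u0 u1].
  by rewrite ger0_norm.
have := drift_lipschitz h0 i; rewrite mulr1.
have -> : drift 0 i = - (1 / 2).
  rewrite /drift (_ : laplacian w r 0 i = 0) ?mulr0 ?ffunE; first by ring.
  by rewrite big1 ?mulr0// => j _; rewrite !ffunE subrr mulr0.
rewrite opprK !ler_norml; lra.
Qed.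

(** A bound for the drift divided by eps: where the reaction vanishes it
    bounds the speed of the flow, and where it acts the flow is at rest almost
    everywhere. *)
Definition flow_speed : R := (drift_lip + 1 / 2) / eps.

Lemma flow_speed_ge0 : 0 <= flow_speed.
Proof.
by rewrite divr_ge0 ?(ltW eps_gt0)// addr_ge0// (le_trans ler01)// drift_lip_ge1.
Qed.

End drift.

(** * Regularity of the Allen-Cahn flow *)

Section AC_flow.
Context {R : realType} {V : finType}.
Notation mu := (@lebesgue_measure R).
Variables (w : V -> V -> R) (r eps : R).
Hypothesis degree_gt0 : forall i, 0 < degree w i.
Hypothesis eps_gt0 : 0 < eps.

(** On a bounded interval a square integrable function is integrable, because
    |y| <= 1 + y^2. *)
Lemma L2_integrable (b : R) (v : R -> {ffun V -> R}) : L2 w r `]0, b[ v ->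
  forall i, mu.-integrable `]0, b[ (EFin \o (fun t => v t i)).
Proof.
move=> [mv v2] i.
have c0 : 0 < degree w i `^ r by exact: powR_gt0.
have mn : measurable_fun `]0, b[ (fun t => vnorm w r (v t) ^+ 2).
  rewrite (_ : (fun _ => _) = fun t => vdot w r (v t) (v t)); last first.
    by apply/funext => t; exact: vnorm_sqr.
  apply: measurable_sum => j; apply: measurable_funM => //.
  exact: measurable_funM.
have nI : mu.-integrable `]0, b[ (EFin \o (fun t => vnorm w r (v t) ^+ 2)).
  apply/integrableP; split; first exact/measurable_EFinP.
  by under eq_integral do rewrite /= ger0_norm ?sqr_ge0//.
have oneI := integrable_cst_oo 0 b 1.
have sI := integrableZlR (degree w i `^ r)^-1 (measurable_itv _) nI.
have sumI : mu.-integrable `]0, b[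
    (EFin \o (fun t => 1 + (degree w i `^ r)^-1 * vnorm w r (v t) ^+ 2)).
  by have := @integrableD _ _ _ mu _ (measurable_itv _) _ _ oneI sI; apply.
apply: (@le_integrable _ _ _ mu _ _ _ _ _ _ sumI) => //.
  by apply/measurable_EFinP; exact: mv.
move=> t _; rewrite /= lee_fin.
set s := vnorm _ _ _ ^+ 2.
have s0 : 0 <= (degree w i `^ r)^-1 * s by rewrite mulr_ge0 ?sqr_ge0// invr_ge0 ltW.
rewrite [leRHS]ger0_norm ?addr_ge0//.
have : (v t i) ^+ 2 <= (degree w i `^ r)^-1 * s.
  by rewrite mulrC ler_pdivlMr// /s vnorm_sqr vdot_ge.
rewrite -(real_normK (num_real (v t i))).
move: `|v t i| (normr_ge0 (v t i)) => y y0 h.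
apply: le_trans (lerD (lexx 1) h); nra.
Qed.

Variables u gamma : R -> {ffun V -> R}.
Hypothesis flow : AC_solution w r eps `[0, +oo[ u gamma.

Lemma AC_ge0_le1 t : 0 <= t -> forall i, 0 <= u t i <= 1.
Proof.
by case: flow => u01 _ _ _ t0 i; have := u01 t; rewrite in_itv/= andbT => /(_ t0 i).
Qed.

Lemma AC_continuous t i : 0 < t -> {for t, continuous (fun x => u x i)}.
Proof.
case: flow => _ _ uC _ t0; have := uC t; rewrite in_itv/= andbT => /(_ (ltW t0)).
move=> /(vcvg_coord degree_gt0)/(_ i).
rewrite within_interior//; apply: filterS (lt_nbhsr t0) => x x0 /=.
by rewrite in_itv/= andbT ltW.
Qed.

Lemma AC_right0 i : u x i @[x --> 0^'+] --> u 0 i.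
Proof.
case: flow => _ _ uC _; have := uC 0; rewrite in_itv/= lexx => /(_ isT).
move=> /(vcvg_coord degree_gt0)/(_ i); apply: cvg_trans.
apply: cvg_app => P; rewrite !nbhs_simpl/= => -[e e0 h].
exists e => // x xe x0; apply: h => //=.
by rewrite in_itv/= andbT ltW.
Qed.

(** The weak time derivative is a genuine one: the flow is its primitive on
    the open half-line. *)
Lemma AC_primitive : exists v : R -> {ffun V -> R},
  [/\ forall i b, 0 < b -> mu.-integrable `]0, b[ (EFin \o (fun t => v t i)),
      forall i s t, 0 < s -> s < t ->
        u t i - u s i = \int[mu]_(x in `]s, t]) v x i
    & {ae mu, forall t, 0 <= t ->
        (forall i, eps * v t i = drift w r eps (u t) i + gamma t i) /\
        obstacle (u t) (gamma t)}].
Proof.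
case: (flow) => u01 uH _ [v [vwd eqn]]; exists v.
have vI i b : 0 < b -> mu.-integrable `]0, b[ (EFin \o (fun t => v t i)).
  move=> b0; apply: L2_integrable.
  by apply: (vwd 0 b _ _ b0).1; rewrite in_itv/= ?lexx// ltW.
split => //.
- move=> i s t s0 st.
  have t0 := lt_trans s0 st.
  have t10 : 0 < t + 1 by rewrite addr_gt0.
  have i0 : (0 : R) \in `[0, +oo[ by rewrite in_itv/= lexx.
  have i1 : t + 1 \in `[0, +oo[ by rewrite in_itv/= ltW.
  have [_ wd] := vwd 0 (t + 1) i0 i1 t10.
  have [[mg _] _] := uH 0 (t + 1) i0 i1 t10.
  apply: (@weak_primitive R 0 (t + 1) (fun t => u t i) (fun t => v t i)) => //.
  + move=> x /=; rewrite in_itv/= => /andP[x0 _].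
    by have /andP[u0 u1] := AC_ge0_le1 (ltW x0) i; rewrite ger0_norm.
  + by move=> x; rewrite in_itv/= => /andP[x0 _]; exact: AC_continuous.
  + exact: vI.
  + by move=> phi tphi; exact: wd.
  + by rewrite ltrDl.
- apply: ae_imply eqn _ => t h t0; have := h; rewrite in_itv/= andbT => /(_ t0) [e ob].
  split => // i; rewrite -e /drift; move: (laplacian _ _ _) => L.
  by rewrite !ffunE /GRing.scale/=; ring.
Qed.

(** A coordinate equal to 0 or 1 is at an extremum, since the flow stays
    between 0 and 1. So almost everywhere its derivative vanishes there, and
    the flow equation then leaves beta = - drift. *)
Lemma AC_contact : {ae mu, forall t, 0 < t -> obstacle (u t) (gamma t) /\
  forall i, u t i = 0 \/ u t i = 1 ->
    gamma t i = - drift w r eps (u t) i /\ is_derive t 1 (fun x => u x i) 0}.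
Proof.
have [v [vI prim eqn]] := AC_primitive.
have der := ae_all_fin (fun i => ae_is_derive_primitive (vI i) (prim i)).
apply: (ae_imply2 eqn der) => t eqt dert t0.
have [e ob] := eqt (ltW t0); split => // i ui.
have dui := dert i t0.
have near_t h : `|h| < t -> 0 <= t + h.
  by rewrite ltr_norml; lra.
have v0 : v t i = 0.
  case: ui => ui.
    apply: (is_derive_local_min t0 _ dui) => h /near_t th.
    by rewrite ui; have /andP[] := AC_ge0_le1 th i.
  apply/eqP; rewrite -oppr_eq0; apply/eqP.
  have dNui := is_deriveN dui.
  apply: (is_derive_local_min t0 _ dNui) => h /near_t th.
  by rewrite /= !fctE ui lerN2; have /andP[] := AC_ge0_le1 th i.
split; last by rewrite -v0.
by have := e i; rewrite v0 mulr0 => /esym/eqP; rewrite addrC addr_eq0 => /eqP.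
Qed.

Local Notation rate := (flow_speed w r eps).

(** Almost everywhere the velocity is drift / eps, or 0 in the contact set;
    both are bounded by the flow speed. *)
Lemma AC_lipschitz i s t : 0 <= s -> s <= t ->
  `|u t i - u s i| <= rate * (t - s).
Proof.
move=> s0; rewrite le_eqVlt => /predU1P[<-|st].
  by rewrite !subrr normr0 mulr0.
have [v [vI prim eqn]] := AC_primitive.
have der := ae_is_derive_primitive (vI i) (prim i).
have vb : {ae mu, forall x, 0 < x -> `|v x i| <= rate}.
  apply: (ae_imply2 (ae_imply2 eqn der (fun x P Q => conj P Q)) AC_contact).
  move=> x [eqx dx] cx x0.
  have u01 : V01 (u x) by move=> j; rewrite /= in_itv/= AC_ge0_le1// ltW.
  have [e ob] := eqx (ltW x0); have [_ cont] := cx x0.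
  rewrite /flow_speed ler_pdivlMr// -[X in _ * X]gtr0_norm// -normrM mulrC e.
  have [ui0|ui0] := eqVneq (u x i) 0.
    have [-> _] := cont i (or_introl ui0).
    by rewrite subrr normr0 addr_ge0// (le_trans ler01)// drift_lip_ge1.
  have [ui1|ui1] := eqVneq (u x i) 1.
    have [-> _] := cont i (or_intror ui1).
    by rewrite subrr normr0 addr_ge0// (le_trans ler01)// drift_lip_ge1.
  have [_ obm _] := ob i; rewrite obm; first by rewrite addr0 drift_le.
  have /andP[u0 u1] := AC_ge0_le1 (ltW x0) i.
  by rewrite !lt_neqAle ui1 eq_sym ui0 u0 u1.
rewrite ler_norml -mulNr; apply/andP; split.
  rewrite -[leRHS]mul1r; apply: (primitive_ge (vI i) (prim i) (@AC_right0 i)) => //.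
  apply: ae_imply vb _ => x vx /andP[sx _]; rewrite mul1r.
  by have := vx (le_lt_trans s0 sx); rewrite ler_norml => /andP[].
rewrite -lerN2 -mulNr -[leRHS]mulN1r.
apply: (primitive_ge (vI i) (prim i) (@AC_right0 i)) => //.
apply: ae_imply vb _ => x vx /andP[sx _]; rewrite mulN1r lerN2.
by have := vx (le_lt_trans s0 sx); rewrite ler_norml => /andP[].
Qed.

(** Away from the upper obstacle the reaction is nonnegative, so the flow
    grows at least as fast as the drift prescribes. *)
Lemma AC_growth i s t m : 0 <= s -> s < t ->
  (forall x, s < x < t -> u x i < 1 /\ m <= drift w r eps (u x) i) ->
  m * (t - s) <= eps * (u t i - u s i).
Proof.
move=> s0 st um; have [v [vI prim eqn]] := AC_primitive.
apply: (primitive_ge (vI i) (prim i) (@AC_right0 i)) => //.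
apply: ae_imply eqn _ => x eqx /andP[sx xt].
have [ux mx] := um x (introT andP (conj sx xt)).
have x0 := ltW (le_lt_trans s0 sx).
have [e ob] := eqx x0; rewrite e (le_trans mx)// lerDl.
have [ob0 obm _] := ob i.
have [ui0|ui0] := eqVneq (u x i) 0; first exact: ob0.
rewrite obm// ux andbT lt_neqAle eq_sym ui0.
by have /andP[] := AC_ge0_le1 x0 i.
Qed.

Lemma AC_decay i s t m : 0 <= s -> s < t ->
  (forall x, s < x < t -> 0 < u x i /\ drift w r eps (u x) i <= m) ->
  eps * (u t i - u s i) <= m * (t - s).
Proof.
move=> s0 st um; have [v [vI prim eqn]] := AC_primitive.
rewrite -lerN2 -!mulNr.
apply: (primitive_ge (vI i) (prim i) (@AC_right0 i)) => //.
apply: ae_imply eqn _ => x eqx /andP[sx xt].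
have [ux mx] := um x (introT andP (conj sx xt)).
have x0 := ltW (le_lt_trans s0 sx).
have [e ob] := eqx x0; rewrite mulNr lerN2 e (le_trans _ mx)// gerDl.
have [_ obm ob1] := ob i.
have [ui1|ui1] := eqVneq (u x i) 1; first exact: ob1.
rewrite obm// ux/= lt_neqAle ui1.
by have /andP[] := AC_ge0_le1 x0 i.
Qed.

End AC_flow.

(** * Consistency of one step of the scheme *)

Section series_tail.
Context {R : realType}.

(** After its first two terms the series is dominated by x^2 times the
    exponential series. *)
Lemma series_exp_tail (a : R^nat) (x : R) : 0 <= x ->
  (forall n, `|a n| <= x ^+ n / n`!%:R) ->
  `|limn (series a) - (a 0%N + a 1%N)| <= x ^+ 2 * expR x.
Proof.
move=> x0 ax.
have ca : cvgn (series a).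
  apply: normed_cvg; apply: (series_le_cvg _ _ _ (is_cvg_series_exp_coeff x)) => n /=.
  - exact: normr_ge0.
  - by rewrite /exp_coeff /= divr_ge0 ?exprn_ge0.
  - exact: ax.
have le_exp n : series (exp_coeff x) n <= expR x.
  apply: nondecreasing_cvgn_le; last exact: is_cvg_series_exp_coeff.
  by apply: nondecreasing_series => k _ _; rewrite /exp_coeff /= divr_ge0 ?exprn_ge0.
have tail n : `|series a n.+2 - (a 0%N + a 1%N)| <= x ^+ 2 * expR x.
  rewrite seriesEnat/= !big_nat_recl//=; set S := \sum_(0 <= _ < _) _.
  rewrite (_ : _ - _ = S); last by ring.
  rewrite /S => {S}.
  apply: le_trans (ler_norm_sum _ _ _) _.
  apply: le_trans (ler_wpM2l (sqr_ge0 x) (le_exp n)).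
  rewrite seriesEnat/= mulr_sumr; apply: ler_sum => k _.
  apply: le_trans (ax _) _; rewrite /exp_coeff /= mulrA -exprD add2n.
  rewrite ler_wpM2l ?exprn_ge0// lef_pV2 ?posrE ?ltr0n ?fact_gt0// ler_nat.
  by rewrite !factS mulnA leq_pmull.
have lim_a : (fun n => `|series a n.+2 - (a 0%N + a 1%N)|) @ \oo -->
    `|limn (series a) - (a 0%N + a 1%N)|.
  apply: cvg_norm; apply: cvgB; last exact: cvg_cst.
  by have := ca; rewrite -(cvg_shiftn 2); under eq_fun do rewrite addn2.
apply: (cvgr_to_le lim_a).
exact: nearW.
Qed.

End series_tail.

Section scheme.
Context {R : realType} {V : finType}.
Variables (w : V -> V -> R) (r eps : R).
Hypothesis eps_gt0 : 0 < eps.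
Implicit Types (u : {ffun V -> R}) (i : V) (t : R).

Lemma iter_laplacian_le u n : (forall j, `|u j| <= 1) ->
  forall i, `|iter n (laplacian w r) u i| <= laplacian_bound w r ^+ n.
Proof.
move=> u1; elim: n => [|n IH] i; first by rewrite expr0.
by rewrite iterS exprS; exact: laplacian_le.
Qed.

Lemma heat_expansion u t i : 0 <= t -> t <= 1 -> (forall j, `|u j| <= 1) ->
  `|heat w r t u i - (u i - t * laplacian w r u i)| <=
    laplacian_bound w r ^+ 2 * expR (laplacian_bound w r) * t ^+ 2.
Proof.
move=> t0 t1 u1; set L := laplacian_bound w r.
have L0 : 0 <= L by exact: laplacian_bound_ge0.
pose a (n : nat) : R := (-1) ^+ n * t ^+ n / n`!%:R * iter n (laplacian w r) u i.
have aE : u i - t * laplacian w r u i = a 0%N + a 1%N.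
  by rewrite /a !factS fact0 muln1 !expr0 !expr1 invr1 /=; ring.
rewrite aE ffunE.
apply: le_trans (series_exp_tail (mulr_ge0 t0 L0) _) _ => [n|].
  rewrite /a !normrM normr_sign mul1r normfV normrX (ger0_norm t0) normr_nat.
  rewrite exprMn [leRHS]mulrAC ler_wpM2l//; last exact: iter_laplacian_le.
  by rewrite divr_ge0 ?exprn_ge0.
rewrite [leRHS]mulrC mulrA -exprMn ler_wpM2l ?sqr_ge0//.
by rewrite ler_expR ler_piMl.
Qed.

(** Replacing the heat operator by 1 - tau Laplacian turns one step into an
    implicit Euler step for the flow, up to an error of order tau^2. *)
Lemma scheme_step : exists2 C : R, 0 <= C & forall (tau : R) u u' b',
  0 < tau -> tau <= 1 -> tau < eps -> V01 u ->
  (1 - tau / eps) *: u' - heat w r tau u + (tau / eps / 2) *: vone R V =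
    (tau / eps) *: b' ->
  forall i, `|(1 - tau / eps) * (u' i - u i) -
              tau / eps * (drift w r eps u i + b' i)| <= tau / eps * (C * tau).
Proof.
set L := laplacian_bound w r.
exists (eps * (L ^+ 2 * expR L)).
  by rewrite mulr_ge0 ?(ltW eps_gt0)// mulr_ge0 ?sqr_ge0// expR_ge0.
move=> tau u u' b' t0 t1 te u01 e i.
have u1 j : `|u j| <= 1.
  have := u01 j; rewrite /= in_itv/= => /andP[? ?].
  by rewrite ger0_norm.
have en0 : eps != 0 by rewrite gt_eqF.
have := heat_expansion i (ltW t0) t1 u1.
have {}e : (1 - tau / eps) * u' i - heat w r tau u i + tau / eps / 2 =
    tau / eps * b' i.
  have := congr1 (fun f : {ffun V -> R} => f i) e.
  by move: (heat _ _ _ _) => h; rewrite !ffunE /GRing.scale/= mulr1.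
rewrite [tau / eps * (_ + b' i)]mulrDr -e /drift -/L.
set h := heat w r tau u i; set l := laplacian w r u i => hl.
rewrite (_ : _ - _ = h - (u i - tau * l)); last by field.
apply: le_trans hl _; rewrite le_eqVlt; apply/orP; left; apply/eqP.
by field.
Qed.

(** The scalar form of the next lemma: dividing by 1 - l instead of 1 changes
    the right-hand side only by a term of order l^2. *)
Let growth_bound (l X F b c K : R) : 0 < l -> l <= 1 / 2 -> 0 <= c ->
  `|F| <= K -> 0 <= b -> `|(1 - l) * X - l * (F + b)| <= l * c ->
  l * (F - (c + 2 * l * (K + c))) <= X.
Proof.
move=> l0 l2 c0 FK b0 h.
have l1 : 0 < 1 - l by lra.
rewrite -(ler_pM2l l1).
apply: (@le_trans _ _ (l * (F - c))); last first.
  by move: h; rewrite ler_norml => /andP[h _]; have := mulr_ge0 (ltW l0) b0; lra.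
rewrite mulrCA ler_pM2l//.
have K0 := le_trans (normr_ge0 F) FK.
move: FK; rewrite ler_norml => /andP[FK _].
have : 0 <= l * ((1 - 2 * l) * (K + c)) by rewrite !mulr_ge0; lra.
have : 0 <= l * (K + F) by rewrite mulr_ge0; lra.
lra.
Qed.

(** The counterparts for the scheme of AC_growth and AC_decay: away from the
    upper (lower) obstacle the reaction has a sign, so the iterate moves at
    least (at most) as the drift prescribes. *)
Lemma scheme_bounds : exists2 C : R, 0 <= C & forall (tau : R) u u' b',
  0 < tau -> tau <= 1 -> tau <= eps / 2 -> V01 u -> V01 u' -> obstacle u' b' ->
  (1 - tau / eps) *: u' - heat w r tau u + (tau / eps / 2) *: vone R V =
    (tau / eps) *: b' ->
  forall i,
  [/\ u' i < 1 -> tau / eps * (drift w r eps u i - C * tau) <= u' i - u i,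
      0 < u' i -> u' i - u i <= tau / eps * (drift w r eps u i + C * tau)
    & `|(1 - tau / eps) * (u' i - u i) -
        tau / eps * (drift w r eps u i + b' i)| <= tau / eps * (C * tau)].
Proof.
have [C0 C00 step] := scheme_step.
pose K := drift_lip w r eps + 1 / 2.
have K0 : 0 <= K by rewrite addr_ge0// (le_trans ler01)// drift_lip_ge1.
pose C := C0 + 2 * (K + C0) / eps.
have CC0 : C0 <= C by rewrite lerDl divr_ge0 ?(ltW eps_gt0)// mulr_ge0// addr_ge0.
exists C; first exact: le_trans CC0.
move=> tau u u' b' t0 t1 te u01 u'01 ob e i.
have lam0 : 0 < tau / eps by rewrite divr_gt0.
have lam2 : tau / eps <= 1 / 2 by rewrite ler_pdivrMr// mulrC mulrA mulr1.
have h : `|(1 - tau / eps) * (u' i - u i) -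
    tau / eps * (drift w r eps u i + b' i)| <= tau / eps * (C0 * tau).
  by apply: step => //; apply: le_lt_trans te _; rewrite ltr_pdivrMr// ltr_pMr// ltr1n.
have FK := drift_le w r eps_gt0 i u01.
have c0 : 0 <= C0 * tau by rewrite mulr_ge0// ltW.
have Ct : C0 * tau + 2 * (tau / eps) * (K + C0 * tau) <= C * tau.
  rewrite (_ : C * tau = C0 * tau + 2 * (tau / eps) * (K + C0)); last first.
    by rewrite /C; field; rewrite gt_eqF.
  have l20 : 0 <= 2 * (tau / eps) by rewrite mulr_ge0// ltW.
  by rewrite lerD2l (ler_wpM2l l20)// lerD2l ler_piMr.
have := u'01 i; rewrite /= in_itv/= => /andP[u0 u1].
have [ob0 obm ob1] := ob i.
split => [ui1|ui0|].
- have b0 : 0 <= b' i.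
    have [ui0|ui0] := eqVneq (u' i) 0; first exact: ob0.
    by rewrite obm// ui1 lt_neqAle eq_sym ui0 u0.
  apply: le_trans (growth_bound lam0 lam2 c0 FK b0 h).
  by rewrite ler_pM2l// lerD2l lerN2.
- have b0 : 0 <= - b' i.
    have [ui1|ui1] := eqVneq (u' i) 1; first by rewrite oppr_ge0 ob1.
    by rewrite obm ?oppr0// ui0 lt_neqAle ui1 u1.
  have h' : `|(1 - tau / eps) * (- (u' i - u i)) -
      tau / eps * (- drift w r eps u i + - b' i)| <= tau / eps * (C0 * tau).
    by rewrite -normrN; move: h; congr (`|_| <= _); ring.
  have := growth_bound lam0 lam2 c0 _ b0 h'; rewrite normrN => /(_ _ FK) g.
  rewrite -lerN2; apply: le_trans g.
  by rewrite -mulrN ler_pM2l// opprD lerD2l lerN2.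
- by apply: le_trans h _; rewrite ler_pM2l// ler_pM2r.
Qed.

End scheme.

(** * Error of the iterates *)

Section step_index.
Context {R : realType}.

Lemma step_index_itv (tau t : R) : 0 < tau -> 0 <= t ->
  t <= (step_index tau t)%:R * tau < t + tau.
Proof.
move=> tau0 t0; rewrite /step_index.
have c0 : (0 <= Num.ceil (t / tau))%R.
  by rewrite ceil_ge0 (lt_le_trans (ltrN10 _))// divr_ge0// ltW.
have -> : (`|Num.ceil (t / tau)|%N%:R : R) = (Num.ceil (t / tau))%:~R.
  by rewrite -[in RHS](gez0_abs c0).
have /andP[h1 h2] := ceil_itv (t / tau).
rewrite -ler_pdivrMr// h2/= -ltr_pdivlMr// mulrDl divff ?gt_eqF//.
by rewrite -ltrBlDr; move: h1; rewrite intrD.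
Qed.

Lemma step_index_gt0 (tau t : R) : 0 < tau -> 0 < t -> (0 < step_index tau t)%N.
Proof.
move=> tau0 t0; have /andP[h _] := step_index_itv tau0 (ltW t0).
rewrite lt0n; apply/eqP => m0; move: h; rewrite m0 mul0r leNgt.
by rewrite t0.
Qed.

End step_index.

Section scheme_error.
Context {R : realType} {V : finType}.
Variables (w : V -> V -> R) (r eps : R).
Hypothesis degree_gt0 : forall i, 0 < degree w i.
Hypothesis eps_gt0 : 0 < eps.
Variables u gamma : R -> {ffun V -> R}.
Hypothesis flow : AC_solution w r eps `[0, +oo[ u gamma.

Local Notation L := (drift_lip w r eps).

Let L_ge0 : 0 <= L.
Proof. by rewrite (le_trans ler01)// drift_lip_ge1. Qed.

Local Notation K := (flow_speed w r eps).

Let K_ge0 : 0 <= K.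
Proof. exact: flow_speed_ge0. Qed.

Let lip i s t : 0 <= s -> s <= t -> `|u t i - u s i| <= K * (t - s).
Proof. exact: (AC_lipschitz degree_gt0 eps_gt0 flow). Qed.

Let drift_near i s t : 0 <= s -> s <= t ->
  `|drift w r eps (u t) i - drift w r eps (u s) i| <= L * (K * (t - s)).
Proof. by move=> s0 st; apply: drift_lipschitz => // j; exact: lip. Qed.

(** Suppose that the new iterate x' lies above the flow at the vertex i. If it
    is positive, the reaction of the scheme does not push it up. Unless the
    flow touches 1 during the step, the reaction of the flow does not push it
    down, so the difference grows only through the difference of the drifts.
    If the flow touches 1, then it remains within K tau of 1, and x' <= 1
    cannot exceed it by more. *)
Lemma one_step_upper (C tau s A x x' : R) i : 0 <= C -> 0 < tau -> 0 <= s ->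
  x - u s i <= A -> x' <= 1 -> K * tau <= A ->
  (0 < x' -> x' - x <= tau / eps * (drift w r eps (u s) i + L * A + C * tau)) ->
  x' - u (s + tau) i <= A + tau / eps * (L * A + (C + L * K) * tau).
Proof.
move=> C0 t0 s0 xA x1 KA step.
have A0 : 0 <= A by apply: le_trans KA; rewrite mulr_ge0// ltW.
have t0' := ltW t0; have sst : s < s + tau by rewrite ltrDl.
have st0 : 0 <= s + tau by rewrite addr_ge0.
have lam0 : 0 < tau / eps by rewrite divr_gt0.
have B0 : 0 <= tau / eps * (L * A + (C + L * K) * tau).
  rewrite (mulr_ge0 (ltW lam0))// addr_ge0 ?(mulr_ge0 L_ge0)//.
  by rewrite mulr_ge0// addr_ge0// mulr_ge0.
have /andP[p0 p1] := AC_ge0_le1 flow st0 i.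
have [x'0|x'0] := ltP 0 x'; last first.
  by rewrite (le_trans (y := 0)) ?addr_ge0// subr_le0 (le_trans x'0).
have [touch|free] := pselect (exists2 y, s < y < s + tau & u y i = 1).
  have [y /andP[sy yt] uy] := touch.
  have := lip i (ltW (le_lt_trans s0 sy)) (ltW yt); rewrite uy ler_norml => /andP[h _].
  have Ky : K * (s + tau - y) <= K * tau by rewrite ler_wpM2l//; lra.
  lra.
have := AC_growth degree_gt0 flow (i := i)
  (m := drift w r eps (u s) i - L * (K * tau)) s0 sst.
have fr y : s < y < s + tau -> u y i < 1 /\
    drift w r eps (u s) i - L * (K * tau) <= drift w r eps (u y) i.
  move=> /andP[sy yt]; have y0 := ltW (le_lt_trans s0 sy); split.
    have /andP[_ uy1] := AC_ge0_le1 flow y0 i; rewrite lt_neqAle uy1 andbT.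
    by apply: contra_notN free => /eqP uy; exists y => //; rewrite sy.
  have := drift_near i s0 (ltW sy); rewrite ler_norml => /andP[h _].
  have : L * (K * (y - s)) <= L * (K * tau).
    by rewrite ler_wpM2l// ler_wpM2l//; lra.
  lra.
move=> /(_ fr); rewrite [s + tau - s]addrAC subrr add0r mulrC => growth.
have {}growth : tau / eps * (drift w r eps (u s) i - L * (K * tau)) <=
    u (s + tau) i - u s i.
  by rewrite mulrAC ler_pdivrMr// [leRHS]mulrC.
have := step x'0; move: growth.
by move: (drift _ _ _ _ _) => F; move: (tau / eps) => l; lra.
Qed.

(** The mirror image of the previous lemma, with the obstacle 0 in place of 1. *)
Lemma one_step_lower (C tau s A x x' : R) i : 0 <= C -> 0 < tau -> 0 <= s ->
  u s i - x <= A -> 0 <= x' -> K * tau <= A ->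
  (x' < 1 -> tau / eps * (drift w r eps (u s) i - L * A - C * tau) <= x' - x) ->
  u (s + tau) i - x' <= A + tau / eps * (L * A + (C + L * K) * tau).
Proof.
move=> C0 t0 s0 xA x1 KA step.
have A0 : 0 <= A by apply: le_trans KA; rewrite mulr_ge0// ltW.
have t0' := ltW t0; have sst : s < s + tau by rewrite ltrDl.
have st0 : 0 <= s + tau by rewrite addr_ge0.
have lam0 : 0 < tau / eps by rewrite divr_gt0.
have B0 : 0 <= tau / eps * (L * A + (C + L * K) * tau).
  rewrite (mulr_ge0 (ltW lam0))// addr_ge0 ?(mulr_ge0 L_ge0)//.
  by rewrite mulr_ge0// addr_ge0// mulr_ge0.
have /andP[p0 p1] := AC_ge0_le1 flow st0 i.
have [x'1|x'1] := ltP x' 1; last first.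
  by rewrite (le_trans (y := 0)) ?addr_ge0// subr_le0 (le_trans p1).
have [touch|free] := pselect (exists2 y, s < y < s + tau & u y i = 0).
  have [y /andP[sy yt] uy] := touch.
  have := lip i (ltW (le_lt_trans s0 sy)) (ltW yt); rewrite uy ler_norml => /andP[_ h].
  have Ky : K * (s + tau - y) <= K * tau by rewrite ler_wpM2l//; lra.
  lra.
have := AC_decay degree_gt0 flow (i := i)
  (m := drift w r eps (u s) i + L * (K * tau)) s0 sst.
have fr y : s < y < s + tau -> 0 < u y i /\
    drift w r eps (u y) i <= drift w r eps (u s) i + L * (K * tau).
  move=> /andP[sy yt]; have y0 := ltW (le_lt_trans s0 sy); split.
    have /andP[uy0 _] := AC_ge0_le1 flow y0 i; rewrite lt_neqAle uy0 andbT.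
    by apply: contra_notN free => /eqP uy; exists y => //; rewrite sy.
  have := drift_near i s0 (ltW sy); rewrite ler_norml => /andP[_ h].
  have : L * (K * (y - s)) <= L * (K * tau).
    by rewrite ler_wpM2l// ler_wpM2l//; lra.
  lra.
move=> /(_ fr); rewrite [s + tau - s]addrAC subrr add0r [leRHS]mulrC => decay.
have {}decay : u (s + tau) i - u s i <=
    tau / eps * (drift w r eps (u s) i + L * (K * tau)).
  by rewrite mulrAC ler_pdivlMr// mulrC.
have := step x'1; move: decay.
by move: (drift _ _ _ _ _) => F; move: (tau / eps) => l; lra.
Qed.

Hypothesis u0_01 : V01 (u 0).

Lemma semi_discrete_01 (tau : R) (us betas : nat -> {ffun V -> R}) :
  semi_discrete w r eps tau (u 0) us betas -> forall n, V01 (us n).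
Proof. by move=> [us0 uS] [|n]; [rewrite us0|have [] := uS n]. Qed.

(** A discrete Gronwall argument on the bound A m for the error after m steps.
    The summand K tau in A m absorbs the case in which the flow touches an
    obstacle during a step. *)
Lemma scheme_error (T : R) : 0 <= T -> exists2 D : R, 0 <= D &
  forall (tau : R) (us betas : nat -> {ffun V -> R}),
  0 < tau -> tau <= 1 -> tau <= eps / 2 ->
  semi_discrete w r eps tau (u 0) us betas ->
  forall n, n%:R * tau <= T -> forall i, `|us n i - u (n%:R * tau) i| <= D * tau.
Proof.
move=> T0; have [C C0 bounds] := scheme_bounds w r eps_gt0.
pose M := (C + L * K) / eps.
have M0 : 0 <= M by rewrite divr_ge0 ?(ltW eps_gt0)// addr_ge0// mulr_ge0.
have Le0 : 0 <= L / eps by rewrite divr_ge0 ?(ltW eps_gt0).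
exists (expR (L / eps * T) * (K + M * T)).
  by rewrite mulr_ge0 ?expR_ge0// addr_ge0// mulr_ge0.
move=> tau us betas t0 t1 te sd n nT i.
have t0' := ltW t0.
have us01 := semi_discrete_01 sd.
have [us0 uS] := sd.
pose q := 1 + L / eps * tau.
have q1 : 1 <= q by rewrite lerDl mulr_ge0.
have q0 : 0 <= q by apply: le_trans q1.
have Mt0 : 0 <= M * tau ^+ 2 by rewrite mulr_ge0 ?sqr_ge0.
have Kt0 : 0 <= K * tau by rewrite mulr_ge0.
pose A m := q ^+ m * (K * tau + m%:R * (M * tau ^+ 2)).
have rec m j : `|us m j - u (m%:R * tau) j| <= A m.
  elim: m j => [|m IH] j.
    by rewrite mul0r us0 subrr normr0 /A expr0 mul1r mul0r addr0 mulr_ge0.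
  have [us'01 ob e] := uS m.
  have [gr de _] := bounds tau _ _ _ t0 t1 te (us01 m) us'01 ob e j.
  have KA : K * tau <= A m.
    apply: (@le_trans _ _ (K * tau + m%:R * (M * tau ^+ 2))).
      by rewrite lerDl mulr_ge0.
    by rewrite ler_peMl ?exprn_ege1// addr_ge0// mulr_ge0.
  have s0 : 0 <= m%:R * tau by rewrite mulr_ge0.
  have := IH j; rewrite ler_norml => /andP[IH1 IH2].
  have := drift_lipschitz w r eps_gt0 IH j; rewrite ler_norml => /andP[dr1 dr2].
  have AS : A m + tau / eps * (L * A m + (C + L * K) * tau) <= A m.+1.
    rewrite (_ : _ + _ = q * A m + M * tau ^+ 2); last first.
      by rewrite /q /M; field; rewrite gt_eqF.
    rewrite (_ : A m.+1 = q * A m + q ^+ m.+1 * (M * tau ^+ 2)); last first.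
      by rewrite /A exprS -natr1; ring.
    by rewrite lerD2l ler_peMl// exprn_ege1.
  have := us'01 j; rewrite /= in_itv/= => /andP[u'0 u'1].
  rewrite -natr1 mulrDl mul1r ler_norml; apply/andP; split.
    rewrite lerNl opprB; apply: le_trans AS.
    apply: (one_step_lower C0 t0 s0 _ u'0 KA (x := us m j)) => [|x1]; first by lra.
    apply: le_trans (gr x1); rewrite ler_pM2l ?divr_gt0//; lra.
  apply: le_trans AS.
  apply: (one_step_upper C0 t0 s0 _ u'1 KA (x := us m j)) => [|x1]; first by lra.
  apply: le_trans (de x1) _; rewrite ler_pM2l ?divr_gt0//; lra.
apply: le_trans (rec n i) _; rewrite /A -mulrA.
have KM : K * tau + n%:R * (M * tau ^+ 2) <= (K + M * T) * tau.
  rewrite (_ : n%:R * _ = M * (n%:R * tau) * tau); last by ring.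
  by rewrite mulrDl lerD2l ler_wpM2r// ler_wpM2l.
apply: ler_pM => //; first exact: exprn_ge0.
  by rewrite addr_ge0// mulr_ge0.
apply: (@le_trans _ _ (expR (L / eps * tau) ^+ n)).
  by rewrite lerXn2r ?nnegrE ?expR_ge0// expR_ge1Dx.
by rewrite -expRM_natl ler_expR mulrCA ler_wpM2l.
Qed.

(** The step index of a time and the neighbouring indices are all within 2 tau
    of it, and the flow is Lipschitz. *)
Lemma scheme_error_near (T : R) : 0 <= T -> exists2 D : R, 0 <= D &
  forall (tau : R) (us betas : nat -> {ffun V -> R}),
  0 < tau -> tau <= 1 -> tau <= eps / 2 ->
  semi_discrete w r eps tau (u 0) us betas ->
  forall n s, 0 <= s -> s <= T -> `|n%:R * tau - s| <= 2 * tau ->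
  forall i, `|us n i - u s i| <= D * tau.
Proof.
move=> T0; have [D D0 err] := scheme_error (addr_ge0 T0 (ler0n R 2)).
exists (D + 2 * K); first by rewrite addr_ge0// mulr_ge0.
move=> tau us betas t0 t1 te sd n s s0 sT ns i.
have nT : n%:R * tau <= T + 2.
  by move: ns; rewrite ler_norml => /andP[_]; lra.
have n0 : 0 <= n%:R * tau by rewrite mulr_ge0// ltW.
have uu : `|u (n%:R * tau) i - u s i| <= 2 * K * tau.
  have lips : `|u (n%:R * tau) i - u s i| <= K * `|n%:R * tau - s|.
    have [ns_|sn_] := leP s (n%:R * tau).
      by rewrite (ger0_norm (x := _ - s)) ?subr_ge0//; exact: lip.
    rewrite distrC (distrC (n%:R * tau)).
    rewrite (ger0_norm (x := s - _)) ?subr_ge0 ?(ltW sn_)//.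
    by apply: lip => //; exact: ltW.
  apply: le_trans lips _.
  by rewrite (_ : 2 * K * tau = K * (2 * tau)); [exact: ler_wpM2l|ring].
rewrite (_ : us n i - u s i =
  (us n i - u (n%:R * tau) i) + (u (n%:R * tau) i - u s i)); last by ring.
apply: le_trans (ler_normD _ _) _; rewrite mulrDl lerD//.
exact: (err tau us betas).
Qed.

End scheme_error.

(** * Reaction of the scheme at a contact time *)

Section contact_force.
Context {R : realType}.

Lemma near0_mul_lt (a c : R) : 0 <= a -> 0 < c -> \forall tau \near 0^'+, a * tau < c.
Proof.
move=> a0 c0; have a1 : 0 < a + 1 by rewrite ltr_wpDl.
near=> tau; apply: (@le_lt_trans _ _ ((a + 1) * tau)).
  by rewrite ler_wpM2r// lerDl.
by rewrite mulrC -ltr_pdivlMr//; near: tau; apply: nbhs_right_lt; rewrite divr_gt0.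
Unshelve. all: by end_near. Qed.

(** Walk back in time from the last iterate k before t: as long as the
    iterates are positive they gain c tau per step backwards, so a positive x
    k would force x to be at least about c d at time t - d. *)
Lemma descent_to_zero (tau c d t p : R) (x : nat -> R) (k : nat) :
  0 < tau -> tau < d -> d <= t ->
  (forall j, 0 <= x j) ->
  (forall j, t - d <= j%:R * tau -> j%:R * tau <= t ->
     0 < x j.+1 -> x j.+1 - x j <= - (c * tau)) ->
  0 < c ->
  t <= k.+1%:R * tau < t + tau ->
  x (step_index tau (t - d)) <= p ->
  p < c * (d - 2 * tau) -> x k = 0.
Proof.
move=> tau0 taud dt x0 dec c0 /andP[tk kt] xp pd.
have [//|xk] := eqVneq (x k) 0.
have {}xk : 0 < x k by rewrite lt_neqAle eq_sym xk x0.
have ktt : k%:R * tau <= t by move: kt; rewrite -natr1; lra.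
have grow n j : (n + j)%N = k -> t - d <= j%:R * tau -> x k + n%:R * (c * tau) <= x j.
  elim: n j => [|n IH] j; first by rewrite add0n => -> _; rewrite mul0r addr0.
  rewrite addSnnS => nj tj.
  have tj1 : t - d <= j.+1%:R * tau by rewrite -natr1 mulrDl mul1r ler_wpDr// ltW.
  have xj1 := IH _ nj tj1.
  have jt : j%:R * tau <= t.
    by apply: le_trans ktt; rewrite ler_pM2r// ler_nat -nj addnS ltnW// ltnS leq_addl.
  have xj10 : 0 < x j.+1.
    by apply: lt_le_trans xj1; rewrite ltr_wpDr// mulr_ge0// mulr_ge0// ltW.
  have := dec j tj jt xj10; move: xj1; rewrite -[n.+1%:R]natr1; lra.
have td0 : 0 <= t - d by rewrite subr_ge0.
have /andP[h1 h2] := step_index_itv tau0 td0.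
set j := step_index tau (t - d) in xp h1 h2.
have jk : (j <= k)%N.
  rewrite leqNgt; apply/negP => kj.
  have : k.+1%:R * tau <= j%:R * tau by rewrite ler_pM2r// ler_nat.
  lra.
have := grow _ _ (subnK jk) h1; rewrite natrB// => g.
suff : c * (d - 2 * tau) <= (k%:R - j%:R) * (c * tau) by lra.
rewrite mulrCA ler_pM2l// mulrBl; move: tk; rewrite -natr1; lra.
Qed.

(** The data of one coordinate of the scheme around a time t at which the flow
    p touches the lower obstacle: iterates x, drifts f, reactions b, the drift
    F of the flow at t; C, D and L are the constants of the errors of order
    tau. Stating it with scalars lets the upper obstacle be treated by the
    reflection x -> 1 - x. *)
Record contact_scheme (eps C D L t F tau : R) (p : R -> R)
    (x f b : nat -> R) : Prop := ContactScheme {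
  contact_ge0 : forall j, 0 <= x j;
  contact_decay : forall j, 0 < x j.+1 ->
    x j.+1 - x j <= tau / eps * (f j + C * tau);
  contact_balance : forall j,
    `|(1 - tau / eps) * (x j.+1 - x j) - tau / eps * (f j + b j.+1)| <=
    tau / eps * (C * tau);
  contact_obstacle : forall j,
    (x j.+1 = 0 -> 0 <= b j.+1) /\ (0 < x j.+1 < 1 -> b j.+1 = 0);
  contact_close : forall j s, 0 <= s -> s <= t -> `|j%:R * tau - s| <= 2 * tau ->
    x j <= p s + D * tau /\ `|f j - F| <= L * (t - s + tau) }.

(** The drift is below - c on a whole interval [t - d, t], which pushes the
    iterates down at a fixed rate. As p is flat at t, they start this interval
    at height at most c d / (4 eps) + O(tau), and reach 0 before the end of
    it. *)
Lemma contact_vanish (eps C D L t F : R) (p : R -> R) :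
  0 < eps -> 0 <= C -> 0 <= D -> 0 <= L -> 0 < t ->
  (forall e, 0 < e -> exists2 d, 0 < d &
     forall h, 0 <= h -> h < d -> p (t - h) <= e * h) ->
  F < 0 -> \forall tau \near 0^'+, forall x f b,
  contact_scheme eps C D L t F tau p x f b ->
  forall k, t <= k.+1%:R * tau < t + tau -> x k = 0 /\ f k + C * tau < 0.
Proof.
move=> eps_gt0 C_ge0 D_ge0 L_ge0 t_gt0 p_flat F_lt0.
pose c := - F / 2; have c0 : 0 < c by rewrite divr_gt0// oppr_gt0.
have FE : F = - (2 * c) by rewrite /c; field.
have ce0 : 0 < c / (4 * eps) by rewrite divr_gt0// mulr_gt0.
have [d0 d00 pd] := p_flat _ ce0.
have cL0 : 0 < c / (2 * (L + 1)) by rewrite divr_gt0// mulr_gt0// ltr_wpDl.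
(* F = - 2 c. The length d keeps the drift below - 3 c / 2 up to O(tau),
   stays inside [0, t], and lies in the range of flatness of p. *)
pose d := Num.min (d0 / 2) (Num.min t (c / (2 * (L + 1)))).
have d_gt0 : 0 < d by rewrite !lt_min t_gt0 cL0 divr_gt0.
have dd0 : d < d0 by rewrite gt_min ltr_pdivrMr// ltr_pMr// ltr1n.
have dt : d <= t by rewrite !ge_min lexx orbT.
have Ld : L * d <= c / 2.
  have : d <= c / (2 * (L + 1)) by rewrite !ge_min lexx !orbT.
  rewrite ler_pdivlMr ?mulr_gt0 ?ltr_wpDl// => h.
  by clear - d_gt0 h; lra.
have B1 : 0 <= D + 2 * (c / eps).
  by rewrite addr_ge0// mulr_ge0// ltW// divr_gt0.
have B2 : 0 < c / (2 * eps) * d by rewrite mulr_gt0// divr_gt0// mulr_gt0.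
near=> tau => x f b sch k tk.
have tau0 : 0 < tau by [].
have taud : tau < d by near: tau; exact: nbhs_right_lt.
have small1 : (L + C) * tau < c / 2.
  by near: tau; apply: near0_mul_lt; rewrite ?addr_ge0// divr_gt0.
have small2 : (D + 2 * (c / eps)) * tau < c / (2 * eps) * d.
  by near: tau; exact: near0_mul_lt.
clearbody c d.
have fneg j s : t - d <= s -> s <= t -> `|j%:R * tau - s| <= 2 * tau ->
    f j + C * tau <= - c.
  move=> ds st js; have s0 : 0 <= s by apply: le_trans ds; rewrite subr_ge0.
  have [_ ] := contact_close sch s0 st js; rewrite ler_norml => /andP[_ h].
  have hL : L * (t - s + tau) <= L * d + L * tau.
    by rewrite -mulrDr ler_wpM2l// lerD2r; clear - ds; lra.
  by clear - h hL FE small1 Ld; lra.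
split; last first.
  apply: le_lt_trans (fneg k t _ (lexx t) _) _; last by rewrite oppr_lt0.
    by rewrite gerBl ltW.
  by move: tk; rewrite -natr1 ler_norml; clear - tau0; lra.
have [x0 dec _ _ close] := sch.
apply: (@descent_to_zero tau (c / eps) d t (p (t - d) + D * tau) x k) => //.
- move=> j dj jt xj; apply: le_trans (dec j xj) _.
  rewrite (_ : - (c / eps * tau) = tau / eps * (- c)); last first.
    by field; rewrite gt_eqF.
  rewrite ler_pM2l ?divr_gt0//; apply: (fneg j (j%:R * tau)) => //.
  by rewrite subrr normr0 mulr_ge0// ltW.
- by rewrite divr_gt0.
- have td0 : 0 <= t - d by rewrite subr_ge0.
  have /andP[h1 h2] := step_index_itv tau0 td0.
  apply: (close _ _ td0 _ _).1; first by rewrite gerBl ltW.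
  by rewrite ler_norml; clear - h1 h2 tau0; lra.
- have := pd d (ltW d_gt0) dd0.
  have -> : c / (4 * eps) * d = c / eps * d / 4 by field; rewrite gt_eqF.
  move: small2.
  have -> : c / (2 * eps) * d = c / eps * d / 2 by field; rewrite gt_eqF.
  have := mulr_gt0 (divr_gt0 c0 eps_gt0) d_gt0.
  by clear; lra.
Unshelve. all: by end_near. Qed.

(** If F < 0 the iterates are at rest at 0 before and after the step, and the
    balance of the step gives b = - f + O(tau). If F = 0 the reaction lies
    between 0 and - f + O(tau), which tends to - F = 0. *)
Lemma contact_force (eps C D L t F : R) (p : R -> R) :
  0 < eps -> 0 <= C -> 0 <= D -> 0 <= L -> 0 < t ->
  (forall e, 0 < e -> exists2 d, 0 < d &
     forall h, 0 <= h -> h < d -> p (t - h) <= e * h) ->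
  F <= 0 -> forall e, 0 < e ->
  \forall tau \near 0^'+, forall x f b,
  contact_scheme eps C D L t F tau p x f b ->
  `|b (step_index tau t) + F| <= e.
Proof.
move=> eps_gt0 C_ge0 D_ge0 L_ge0 t_gt0 p_flat F_le0 e e0.
have pt : p t <= 0.
  have [d d0 /(_ 0 (lexx _) d0)] := p_flat _ ltr01.
  by rewrite subr0 mulr0.
have vanish : \forall tau \near 0^'+, F < 0 -> forall x f b,
    contact_scheme eps C D L t F tau p x f b ->
    forall k, t <= k.+1%:R * tau < t + tau -> x k = 0 /\ f k + C * tau < 0.
  have [F_lt0|F_ge0] := ltP F 0; last by near=> tau.
  have := contact_vanish eps_gt0 C_ge0 D_ge0 L_ge0 t_gt0 p_flat F_lt0.
  by apply: filterS => tau h _; exact: h.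
near=> tau => x f b sch.
have [x0 dec bal ob close] := sch.
have tau0 : 0 < tau by [].
have small : (L + C) * tau < e by near: tau; apply: near0_mul_lt; rewrite ?addr_ge0.
have D1 : D * tau < 1 by near: tau; exact: near0_mul_lt.
have taue : tau < eps by near: tau; exact: nbhs_right_lt.
have lam0 : 0 < tau / eps by rewrite divr_gt0.
have lam1 : 0 < 1 - tau / eps by rewrite subr_gt0 ltr_pdivrMr// mul1r.
have := step_index_itv tau0 (ltW t_gt0); have := step_index_gt0 tau0 t_gt0.
case: (step_index tau t) => // k _ tk.
have zero_k : F < 0 -> x k = 0 /\ f k + C * tau < 0.
  move=> F_lt0; suff h : F < 0 -> forall x f b,
      contact_scheme eps C D L t F tau p x f b ->
      forall k, t <= k.+1%:R * tau < t + tau -> x k = 0 /\ f k + C * tau < 0.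
    exact: (h F_lt0 _ _ _ sch).
  by near: tau.
have [_] : x k <= p t + D * tau /\ `|f k - F| <= L * (t - t + tau).
  apply: close => //; first exact: ltW.
  by move: tk; rewrite -natr1 ler_norml; clear - tau0; lra.
rewrite subrr add0r ler_norml => /andP[fF1 fF2].
have [xk1 _] : x k.+1 <= p t + D * tau /\ `|f k.+1 - F| <= L * (t - t + tau).
  apply: close => //; first exact: ltW.
  by move: tk; rewrite ler_norml; clear - tau0; lra.
have [ob0 obm] := ob k.
have [xz|xnz] := eqVneq (x k.+1) 0.
  have b0 := ob0 xz.
  have := bal k; rewrite xz sub0r ler_norml => /andP[bal1 bal2].
  have xk0 := mulr_ge0 (ltW lam1) (x0 k).
  have bu : b k.+1 <= - f k + C * tau.
    rewrite -(ler_pM2l lam0) mulrDr mulrN; move: bal1 xk0; rewrite mulrN mulrDr.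
    by clear; lra.
  rewrite ler_norml; apply/andP; split; last by clear - fF2 fF1 bu small; lra.
  have [/zero_k[xk _]|F_ge0] := ltP F 0; last by clear - b0 F_ge0 e0; lra.
  have bl : - f k - C * tau <= b k.+1.
    rewrite -(ler_pM2l lam0); move: bal2; rewrite xk oppr0 mulr0 sub0r.
    by clear; lra.
  by clear - bl fF1 fF2 small; lra.
have xp : 0 < x k.+1 by rewrite lt_neqAle eq_sym xnz x0.
rewrite obm; last by rewrite xp/=; clear - xk1 pt D1; lra.
rewrite add0r; have [/zero_k[xk fk]|F_ge0] := ltP F 0; last first.
  by rewrite (_ : F = 0) ?normr0 ?(ltW e0)//; apply/eqP; rewrite eq_le F_le0.
have := dec k xp; rewrite xk subr0.
have : tau / eps * (f k + C * tau) < 0 by rewrite pmulr_rlt0.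
by clear - xp; lra.
Unshelve. all: by end_near. Qed.

End contact_force.

(** * Pointwise limits and the theorem *)

Section limits.
Context {R : realType} {V : finType}.
Variables (w : V -> V -> R) (r eps : R).
Hypothesis degree_gt0 : forall i, 0 < degree w i.
Hypothesis eps_gt0 : 0 < eps.
Variables u gamma : R -> {ffun V -> R}.
Hypothesis flow : AC_solution w r eps `[0, +oo[ u gamma.
Hypothesis u0_01 : V01 (u 0).

Let near_admissible : \forall tau \near 0^'+, [/\ 0 < tau, tau <= 1 & tau <= eps / 2].
Proof.
near=> tau; split => //; first by near: tau; apply: nbhs_right_le.
by near: tau; apply: nbhs_right_le; rewrite divr_gt0.
Unshelve. all: by end_near. Qed.

Lemma iterate_limit t i (e : R) : 0 <= t -> 0 < e ->
  \forall tau \near 0^'+, forall us betas : nat -> {ffun V -> R},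
    semi_discrete w r eps tau (u 0) us betas ->
    `|us (step_index tau t) i - u t i| <= e.
Proof.
move=> t0 e0.
have [D D0 err] := scheme_error_near degree_gt0 eps_gt0 flow u0_01 t0.
near=> tau => us betas sd.
have [tau0 tau1 taue] : [/\ 0 < tau, tau <= 1 & tau <= eps / 2].
  by near: tau; exact: near_admissible.
apply: le_trans (err tau us betas tau0 tau1 taue sd _ _ t0 (lexx t) _ i) _.
  by have := step_index_itv tau0 t0; rewrite ler_norml; lra.
by apply: ltW; near: tau; exact: near0_mul_lt.
Unshelve. all: by end_near. Qed.

Lemma drift_iterate_close t : 0 <= t -> exists2 L : R, 0 <= L &
  forall tau us betas, 0 < tau -> tau <= 1 -> tau <= eps / 2 ->
  semi_discrete w r eps tau (u 0) us betas ->
  forall j s, 0 <= s -> s <= t -> `|j%:R * tau - s| <= 2 * tau ->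
  forall i,
  `|drift w r eps (us j) i - drift w r eps (u t) i| <= L * (t - s + tau).
Proof.
move=> t0.
have [D D0 err] := scheme_error_near degree_gt0 eps_gt0 flow u0_01 t0.
have Ld0 : 0 <= drift_lip w r eps by rewrite (le_trans ler01)// drift_lip_ge1.
have K0 := flow_speed_ge0 w r eps_gt0.
exists (drift_lip w r eps * (D + flow_speed w r eps)).
  by rewrite mulr_ge0// addr_ge0.
move=> tau us betas tau0 tau1 taue sd j s s0 st js i.
apply: le_trans (@drift_lipschitz _ _ w r _ eps_gt0 _ _
  (D * tau + flow_speed w r eps * (t - s)) _ i) _ => [k|].
  rewrite (_ : us j k - u t k = (us j k - u s k) + (u s k - u t k)); last by ring.
  apply: le_trans (ler_normD _ _) _; rewrite lerD//.
    exact: err sd _ _ s0 st js _.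
  by rewrite distrC; exact: (AC_lipschitz degree_gt0 eps_gt0 flow).
rewrite -mulrA ler_wpM2l//.
have : 0 <= flow_speed w r eps * tau by rewrite mulr_ge0// ltW.
have : 0 <= D * (t - s) by rewrite mulr_ge0// subr_ge0.
lra.
Qed.

(** The reaction of the flow at a contact point is - drift, and the scalar
    lemma applies to the coordinate i itself. *)
Lemma force_limit_lower t i (e : R) : 0 < t ->
  u t i = 0 -> is_derive t 1 (fun x => u x i) 0 -> drift w r eps (u t) i <= 0 ->
  0 < e ->
  \forall tau \near 0^'+, forall us betas : nat -> {ffun V -> R},
    semi_discrete w r eps tau (u 0) us betas ->
    `|betas (step_index tau t) i - - drift w r eps (u t) i| <= e.
Proof.
move=> t0 ut du F0 e0.
have [C C0 bounds] := scheme_bounds w r eps_gt0.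
have [D D0 err] := scheme_error_near degree_gt0 eps_gt0 flow u0_01 (ltW t0).
have [L L0 drift_close] := drift_iterate_close (ltW t0).
have flat_p e' : 0 < e' -> exists2 d, 0 < d &
    forall h, 0 <= h -> h < d -> u (t - h) i <= e' * h.
  move=> e'0; have [d d0 H] := is_derive_expansion du e'0.
  exists d => // h h0 hd; have := H (- h); rewrite normrN ger0_norm// => /(_ hd).
  by rewrite mul0r subr0 ut subr0; apply: le_trans; exact: ler_norm.
have := contact_force (p := fun s => u s i) eps_gt0 C0 D0 L0 t0 flat_p F0 e0.
apply: filterS2 near_admissible => tau [tau0 tau1 taue] H us betas sd.
have us01 := semi_discrete_01 u0_01 sd; have [_ uS] := sd.
rewrite opprK.
apply: (H (fun j => us j i) (fun j => drift w r eps (us j) i)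
          (fun j => betas j i)); split.
- by move=> j; have := us01 j i; rewrite /= in_itv/= => /andP[].
- move=> j; have [u'01 ob' e'] := uS j.
  by have [] := bounds _ _ _ _ tau0 tau1 taue (us01 j) u'01 ob' e' i.
- move=> j; have [u'01 ob' e'] := uS j.
  by have [] := bounds _ _ _ _ tau0 tau1 taue (us01 j) u'01 ob' e' i.
- by move=> j; have [_ ob' _] := uS j; have [] := ob' i.
- move=> j s s0 st js; split; last exact: drift_close sd _ _ s0 st js _.
  have := err _ _ _ tau0 tau1 taue sd _ _ s0 st js i.
  by rewrite ler_norml lerBlDl => /andP[].
Qed.

(** Reflection x -> 1 - x, which changes the signs of drift and reaction. *)
Lemma force_limit_upper t i (e : R) : 0 < t ->
  u t i = 1 -> is_derive t 1 (fun x => u x i) 0 -> 0 <= drift w r eps (u t) i ->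
  0 < e ->
  \forall tau \near 0^'+, forall us betas : nat -> {ffun V -> R},
    semi_discrete w r eps tau (u 0) us betas ->
    `|betas (step_index tau t) i - - drift w r eps (u t) i| <= e.
Proof.
move=> t0 ut du; rewrite -oppr_le0 => F0 e0.
have [C C0 bounds] := scheme_bounds w r eps_gt0.
have [D D0 err] := scheme_error_near degree_gt0 eps_gt0 flow u0_01 (ltW t0).
have [L L0 drift_close] := drift_iterate_close (ltW t0).
have flat_p e' : 0 < e' -> exists2 d, 0 < d &
    forall h, 0 <= h -> h < d -> 1 - u (t - h) i <= e' * h.
  move=> e'0; have [d d0 H] := is_derive_expansion du e'0.
  exists d => // h h0 hd; have := H (- h); rewrite normrN ger0_norm// => /(_ hd).
  by rewrite mul0r subr0 ut distrC; apply: le_trans; exact: ler_norm.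
have := contact_force (p := fun s => 1 - u s i) eps_gt0 C0 D0 L0 t0 flat_p F0 e0.
apply: filterS2 near_admissible => tau [tau0 tau1 taue] H us betas sd.
have us01 := semi_discrete_01 u0_01 sd; have [_ uS] := sd.
rewrite -normrN opprB addrC.
apply: (H (fun j => 1 - us j i) (fun j => - drift w r eps (us j) i)
          (fun j => - betas j i)); split.
- by move=> j; have := us01 j i; rewrite /= in_itv/= subr_ge0 => /andP[].
- move=> j; have [u'01 ob' e'] := uS j; rewrite subr_gt0 => x1.
  have [gr _ _] := bounds _ _ _ _ tau0 tau1 taue (us01 j) u'01 ob' e' i.
  have := gr x1; rewrite -lerN2 -mulrN; congr (_ <= _ * _); ring.
- move=> j; have [u'01 ob' e'] := uS j.
  have [_ _] := bounds _ _ _ _ tau0 tau1 taue (us01 j) u'01 ob' e' i.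
  by rewrite -normrN; congr (`|_| <= _); ring.
- move=> j; have [_ ob' _] := uS j; have [_ obm' ob1'] := ob' i; split.
    by move=> /eqP; rewrite subr_eq0 eq_sym => /eqP/ob1'; rewrite oppr_ge0.
  by move=> h; rewrite obm' ?oppr0//; move: h; lra.
- move=> j s s0 st js; split.
    have := err _ _ _ tau0 tau1 taue sd _ _ s0 st js i.
    by rewrite ler_norml; lra.
  by rewrite -opprD normrN; exact: drift_close sd _ _ s0 st js _.
Qed.

(** The iterates also lie strictly between the obstacles for small tau. *)
Lemma force_limit_free t i (e : R) : 0 < t -> 0 < u t i < 1 -> 0 < e ->
  \forall tau \near 0^'+, forall us betas : nat -> {ffun V -> R},
    semi_discrete w r eps tau (u 0) us betas ->
    `|betas (step_index tau t) i| <= e.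
Proof.
move=> t0 /andP[u_gt0 u_lt1] e0.
pose d := Num.min (u t i) (1 - u t i) / 2.
have d0 : 0 < d by rewrite divr_gt0// lt_min u_gt0 subr_gt0.
have du : d < u t i.
  rewrite ltr_pdivrMr// (@le_lt_trans _ _ (u t i))// ?ge_min ?lexx//.
  by rewrite ltr_pMr// ltr1n.
have d1 : d < 1 - u t i.
  rewrite ltr_pdivrMr// (@le_lt_trans _ _ (1 - u t i))// ?ge_min ?lexx ?orbT//.
  by rewrite ltr_pMr ?subr_gt0// ltr1n.
have := iterate_limit i (ltW t0) d0.
apply: filterS2 near_admissible => tau [tau0 tau1 taue] H us betas sd.
have := H us betas sd; have := step_index_gt0 tau0 t0.
case: (step_index tau t) => // k _; rewrite ler_norml => /andP[h1 h2].
have [_ uS] := sd; have [_ ob' _] := uS k; have [_ obm' _] := ob' i.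
rewrite obm'; first by rewrite normr0 ltW.
by clearbody d; lra.
Qed.

Lemma force_limit t i (e : R) : 0 < t -> obstacle (u t) (gamma t) ->
  (u t i = 0 \/ u t i = 1 ->
     gamma t i = - drift w r eps (u t) i /\ is_derive t 1 (fun x => u x i) 0) ->
  0 < e ->
  \forall tau \near 0^'+, forall us betas : nat -> {ffun V -> R},
    semi_discrete w r eps tau (u 0) us betas ->
    `|betas (step_index tau t) i - gamma t i| <= e.
Proof.
move=> t0 ob contact e0; have [ob0 obm ob1] := ob i.
have [u0|un0] := eqVneq (u t i) 0.
  have [gE du] := contact (or_introl u0); rewrite gE.
  by apply: force_limit_lower => //; rewrite -oppr_ge0 -gE; exact: ob0.
have [u1|un1] := eqVneq (u t i) 1.
  have [gE du] := contact (or_intror u1); rewrite gE.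
  by apply: force_limit_upper => //; rewrite -oppr_le0 -gE; exact: ob1.
have ui : 0 < u t i < 1.
  have /andP[u_ge0 u_le1] := AC_ge0_le1 flow (ltW t0) i.
  by rewrite !lt_neqAle eq_sym un0 un1 u_ge0.
have := force_limit_free t0 ui e0; apply: filterS => tau H us betas sd.
by rewrite obm// subr0; exact: H sd.
Qed.

End limits.

Lemma cvg_at_right0 {R : realType} (a : nat -> R) : (forall n, 0 < a n) ->
  a n @[n --> \oo] --> (0 : R) -> a n @[n --> \oo] --> 0^'+.
Proof.
move=> a0 a_cvg P; rewrite nbhs_simpl/= => -[e e0 h].
have /cvgrPdist_lt/(_ _ e0) := a_cvg.
by rewrite nbhs_simpl/=; apply: filterS => n an; apply: h => //=; rewrite /ball/=.
Qed.

Theorem theorem5p4 (R : realType) (V : finType) (E : rel V) (w : V -> V -> R)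
    (r eps : R) (u0 : {ffun V -> R}) (tau : nat -> R)
    (hG : weighted_graph E w) (hr : 0 <= r <= 1) (hu0 : V01 u0)
    (heps : 0 < eps) (htau_gt0 : forall n, 0 < tau n)
    (htau_dec : {homo tau : m n / (m <= n)%N >-> n <= m})
    (htau_cvg : tau n @[n --> \oo] --> (0 : R)) :
  exists sigma : nat -> nat,
    [/\ {homo sigma : m n / (m < n)%N},
        forall n, tau (sigma n) < eps
      & forall us betas : nat -> nat -> {ffun V -> R},
          (forall n, semi_discrete w r eps (tau (sigma n)) u0
                       (us n) (betas n)) ->
        forall uhat gamma : R -> {ffun V -> R},
          AC_solution w r eps `[0, +oo[ uhat gamma -> uhat 0 = u0 ->
        (forall t : R, 0 <= t ->
           vcvg w r (fun n => us n (step_index (tau (sigma n)) t)) \oo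
             (uhat t)) /\
        exists N : nat -> nat,
          [/\ forall k, (0 < N k)%N,
              N k @[k --> \oo] --> \oo
            & {ae @lebesgue_measure R, forall t : R, 0 <= t ->
                vcvg w r
                  (fun k => (N k)%:R^-1 *:
                     \sum_(n < N k) betas n (step_index (tau (sigma n)) t))
                  \oo (gamma t)}]].
Proof.
have deg := degree_gt0 hG.
have [n0 _ tau_eps] : \forall n \near \oo, tau n < eps.
  have /cvgrPdist_lt/(_ _ heps) := htau_cvg.
  by apply: filterS => n; rewrite sub0r normrN gtr0_norm.
(* Only the terms with tau n >= eps have to be dropped, since the whole
   remaining sequence converges. *)
exists (fun n => n + n0)%N; split.
- by move=> m n mn; rewrite ltn_add2r.
- by move=> n; apply: tau_eps => /=; exact: leq_addl.
move=> us betas sd uhat gamma flow uhat0.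
have u01 : V01 (uhat 0) by rewrite uhat0.
have tau_right : tau (n + n0)%N @[n --> \oo] --> 0^'+.
  apply: cvg_at_right0 => //.
  by have := htau_cvg; rewrite -(cvg_shiftn n0).
have along (P : R -> (nat -> {ffun V -> R}) -> (nat -> {ffun V -> R}) -> Prop) :
    (\forall tau \near 0^'+, forall us betas,
      semi_discrete w r eps tau (uhat 0) us betas -> P tau us betas) ->
    \forall n \near \oo, P (tau (n + n0)%N) (us n) (betas n).
  move=> /tau_right; rewrite nbhs_simpl/=; apply: filterS => n; apply.
  by rewrite uhat0.
split.
  move=> t t0; apply: coord_vcvg => i; apply/cvgrPdist_le => e e0.
  have := along _ (iterate_limit deg heps flow u01 i t0 e0).
  by apply: filterS => n; rewrite distrC.
(* The reactions themselves converge almost everywhere, so by Cesaro so do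
   their means over all nonempty initial segments. *)
exists succn; split => //.
  by move=> P [m _ mP]; exists m => // k /= mk; apply: mP => /=; exact: leqW.
have t_neq0 : {ae @lebesgue_measure R, forall t : R, t <> 0}.
  exists [set 0]; split => //; first exact: lebesgue_measure_set1.
  by move=> t /= /contrapT.
apply: (ae_imply2 (AC_contact deg flow) t_neq0) => t contact /eqP tn0 t0.
have {}t0 : 0 < t by rewrite lt_neqAle eq_sym tn0.
have [ob cont] := contact t0.
apply: coord_vcvg => i.
have force : betas n (step_index (tau (n + n0)%N) t) i @[n --> \oo] --> gamma t i.
  apply/cvgrPdist_le => e e0.
  have := along _ (force_limit deg heps flow u01 t0 ob (cont i) e0).
  by apply: filterS => n; rewrite distrC.
have := cesaro force; rewrite /arithmetic_mean; apply: cvg_trans.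
apply: near_eq_cvg; apply: nearW => k /=.
rewrite seriesEord/= !ffunE sum_ffunE.
by [].
Qed.
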